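(* Let $m,n\in\mathbb{Z}_{>0}$, $E_1=\{1,\dots,m\}$, $E_2=\{m+1,\dots,m+n\}$, $\alpha\in\mathbb{Z}_{\ge0}^m$, $\beta\in\mathbb{Z}_{\ge0}^n$, let $(\mathscr{C},(\alpha,\beta))$ be a caged polymatroid on $E_1\cup E_2$, and let $\mathbb{K}$ be a field. If $\mathscr{C}$ is an algebraic polymatroid over $\mathbb{K}$, then the polymatroid correspondence $\mathscr{C}_*$ maps algebraic polymatroids over $\mathbb{K}$ (on $E_1$ with cage $\alpha$) to algebraic polymatroids over $\mathbb{K}$ (on $E_2$ with cage $\beta$).
   Context: A polymatroid $P$ on a finite set $E$ is given by a rank function $\mathrm{rk}:2^E\to\mathbb{Z}_{\ge0}$ that is normalized ($\mathrm{rk}(\emptyset)=0$), increasing and submodular. Its set of bases $\mathcal{B}_P$ consists of the $\beta\in\mathbb{Z}_{\ge0}^E$ with $\sum_{i\in E}\beta_i=\mathrm{rk}(E)$ and $\sum_{i\in A}\beta_i\le\mathrm{rk}(A)$ for all $A\subsetneq E$; $P$ is determined by $\mathcal{B}_P$, and the sets $\mathcal{B}_P$ are exactly the M-convex sets (nonempty subsets of some $\{\gamma\in\mathbb{Z}_{\ge0}^E:\sum\gamma_i=r\}$ satisfying: for all $u,v$ in the set and $i$ with $u_i<v_i$ there is $j$ with $u_j>v_j$ such that $u-e_j+e_i$ and $v-e_i+e_j$ are in the set). A cage for $P$ is $\alpha\in\mathbb{Z}_{\ge0}^E$ with $\mathrm{rk}(\{i\})\le\alpha_i$ for all $i$; $(P,\alpha)$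 is then a caged polymatroid. Deletion $P\setminus D$ is restriction of the rank function to subsets of $E\setminus D$; the direct sum has rank function the sum of the rank functions. $\mathbf{B}_\beta$ is the Boolean polymatroid with cage $\beta$: $\mathrm{rk}(S)=\sum_{i\in S}\beta_i$. Polymatroid intersection: for two polymatroids $P,Q$ with the same cage $\alpha$, $P\wedge_\alpha Q$ is the polymatroid (with cage $\alpha$) whose bases are the componentwise-minimal elements of $\{\beta_P\cap_\alpha\beta_Q:\beta_P\in\mathcal{B}_P,\beta_Q\in\mathcal{B}_Q\}$, where $(\beta\cap_\alpha\gamma)_i=\max\{\beta_i+\gamma_i-\alpha_i,0\}$ (these are known to form an M-convex set). Polymatroid correspondence: for $P$ a polymatroid on $E_1$ with cage $\alpha$, $\mathscr{C}_*(P):=\big((P\oplus\mathbf{B}_\beta)\wedge_{(\alpha,\beta)}\mathscr{C}\big)\setminus E_1$, a polymatroid on $E_2$ with cage $\beta$. A polymatroid $P$ on $E$ is algebraic over $\mathbb{K}$ if there are a field extension $L/\mathbb{K}$ and intermediate fields $\mathbb{K}\subseteq L_i\subseteq L$ ($i\in E$) such that $\mathrm{rk}(S)=\operatorname{tr.deg}_{\mathbb{K}}\mathbb{K}\big(\bigcup_{i\in S}L_i\big)$ for all $S\subseteq E$. *)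

(* Defs.v *)
From mathcomp Require Import all_boot all_order all_algebra.
From mathcomp Require Import mpoly zify.

Set Implicit Arguments.
Unset Strict Implicit.
Unset Printing Implicit Defensive.

Import GRing.Theory.

(** * Polymatroids *)

Record polymatroid (E : finType) := Polymatroid {
  rk :> {set E} -> nat;
  rk0 : rk set0 = 0;
  rk_mono : forall A B : {set E}, A \subset B -> rk A <= rk B;
  rk_submod : forall A B : {set E},
    rk (A :|: B) + rk (A :&: B) <= rk A + rk B }.

Section Bases.
Variable E : finType.
Implicit Types (P : polymatroid E) (b c z : {ffun E -> nat}) (A S : {set E}).

Definition wt b A := \sum_(i in A) b i.

Definition basis P b :=
  wt b setT = P setT /\ forall A, A \proper setT -> wt b A <= P A.

Definition is_cage (a : {ffun E -> nat}) P := forall i, P [set i] <= a i.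

Definition vle b c := [forall i, b i <= c i].

Definition minimal_in (X : {ffun E -> nat} -> Prop) b :=
  X b /\ forall c, X c -> vle c b -> c = b.

(* Truncated subtraction on nat already gives the maximum with 0. *)
Definition cap (a b c : {ffun E -> nat}) : {ffun E -> nat} :=
  [ffun i => maxn (b i + c i - a i) 0].

Definition caps a P Q d :=
  exists b c, [/\ basis P b, basis Q c & d = cap a b c].

End Bases.

Record cagedPolymatroid (E : finType) (a : {ffun E -> nat}) := Caged {
  pm :> polymatroid E;
  cageP : is_cage a pm }.

(** * Existence of the intersection

    The componentwise minimal elements of [caps a P Q] are the bases of a
    polymatroid: complementing in the cage [a] turns them into the bases of the
    truncation to [a] of the sum of the two dual polymatroids. *)

Section Theory.
Variable E : finType.
Implicit Types (P Q : polymatroid E) (a b c z x y t : {ffun E -> nat}).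
Implicit Types (A B S T : {set E}) (i : E).

Definition indep P z := forall A, wt z A <= P A.

Lemma wt0 z : wt z set0 = 0. Proof. by rewrite /wt big_set0. Qed.

Lemma wt1 z i : wt z [set i] = z i. Proof. by rewrite /wt big_set1. Qed.

Lemma wtI z A B : wt z A = wt z (A :&: B) + wt z (A :\: B).
Proof. exact: big_setID. Qed.

Lemma wtC z A : wt z setT = wt z A + wt z (~: A).
Proof. by rewrite (wtI z setT A) setTI setTD. Qed.

Lemma wt_modular z A B : wt z (A :|: B) + wt z (A :&: B) = wt z A + wt z B.
Proof.
rewrite (wtI z (A :|: B) A) setUK setDUl setDv set0U (wtI z B A) setIC; lia.
Qed.

Lemma wt_sub z A B : A \subset B -> wt z A <= wt z B.
Proof. by move=> /setIidPr sAB; rewrite (wtI z B A) sAB leq_addr. Qed.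

Lemma wt_le x y A : vle x y -> wt x A <= wt y A.
Proof. by move=> /forallP le_xy; apply: leq_sum. Qed.

Lemma wtD x y A : wt [ffun i => x i + y i] A = wt x A + wt y A.
Proof. by rewrite /wt -big_split; apply: eq_bigr => i _; rewrite ffunE. Qed.

Lemma wt_delta i A : wt [ffun j => (j == i : nat)] A = (i \in A).
Proof.
rewrite /wt; under eq_bigr do rewrite ffunE.
case: (boolP (i \in A)) => [iA | niA].
  by rewrite (bigD1 i) //= eqxx big1 // => j /andP[_ /negbTE->].
by rewrite big1 // => j jA; case: eqP jA niA => // -> ->.
Qed.

Lemma wt_compl a b A : vle b a -> wt [ffun i => a i - b i] A = wt a A - wt b A.
Proof.
move=> le_ba; have /forallP le := le_ba.
suff: wt a A = wt [ffun i => a i - b i] A + wt b A by move=> ->; rewrite addnK.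
rewrite -wtD; apply: eq_bigr => i _; rewrite !ffunE subnK //.
Qed.

Lemma vle_refl x : vle x x. Proof. by apply/forallP. Qed.

Lemma vle_trans x y z : vle x y -> vle y z -> vle x z.
Proof.
move=> /forallP xy /forallP yz; apply/forallP => i.
exact: leq_trans (xy i) (yz i).
Qed.

Lemma vle_wt_eq x y : vle x y -> wt y setT <= wt x setT -> x = y.
Proof.
move=> le_xy; have /forallP le := le_xy => le_yx; apply/ffunP => i.
have := wtC x [set i]; have := wtC y [set i]; rewrite !wt1.
have := wt_le (~: [set i]) le_xy; have := le i; lia.
Qed.

Lemma basisP P b : basis P b <-> indep P b /\ wt b setT = P setT.
Proof.
split=> [[bT bP]|[bP bT]]; last by split=> // A _; apply: bP.
split=> // A; case: (boolP (A \proper setT)) => [/bP //|].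
by rewrite properT negbK => /eqP->; rewrite bT.
Qed.

Lemma indep_vle P x y : vle x y -> indep P y -> indep P x.
Proof. by move=> xy yP A; apply: leq_trans (wt_le A xy) (yP A). Qed.

Lemma indep_extend P z : indep P z -> exists2 b, basis P b & vle z b.
Proof.
move eq_n: (P setT - wt z setT) => n.
elim: n z eq_n => [|n IHn] z eq_n zP.
  exists z; last exact: vle_refl.
  by apply/basisP; split=> //; have := zP setT; lia.
pose tight A := wt z A == P A.
have tightU A B : tight A -> tight B -> tight (A :|: B).
  rewrite /tight => /eqP tA /eqP tB.
  have := rk_submod P A B; have := wt_modular z A B.
  by have := zP (A :|: B); have := zP (A :&: B); lia.
have tight0 : tight set0 by rewrite /tight wt0 rk0.
case: (boolP [forall i, [exists A : {set E}, (i \in A) && tight A]]) => [/forallP all_t|].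
  have : tight (\bigcup_(A | tight A) A) by elim/big_ind: _.
  have -> : \bigcup_(A | tight A) A = setT.
    apply/setP=> i; rewrite inE; have /existsP[A /andP[iA tA]] := all_t i.
    by apply/bigcupP; exists A.
  by rewrite /tight; lia.
rewrite negb_forall => /existsP[i]; rewrite negb_exists => /forallP ni.
pose z' : {ffun E -> nat} := [ffun j => z j + [ffun k => (k == i : nat)] j].
have wz' A : wt z' A = wt z A + (i \in A) by rewrite wtD wt_delta.
have z'P : indep P z'.
  move=> A; rewrite wz'; have := zP A; have := ni A.
  by rewrite /tight; case: (i \in A); lia.
have [|b bP le_b] := IHn z' _ z'P.
  by rewrite wz' inE; lia.
exists b => //; apply: vle_trans le_b; apply/forallP => j.
by rewrite !ffunE leq_addr.
Qed.

Lemma indep0 P : indep P [ffun=> 0].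
Proof. by move=> A; rewrite /wt big1 // => i _; rewrite ffunE. Qed.

Definition restr (P : polymatroid E) (S : {set E}) : polymatroid E.
Proof.
exists (fun A => P (A :&: S)).
- by rewrite set0I rk0.
- by move=> A B sAB; apply: rk_mono; apply: setSI.
- by move=> A B; rewrite setIUl (setIIl A B S); apply: rk_submod.
Defined.

Lemma rk_attained P S : exists2 b, basis P b & wt b S = P S.
Proof.
have [z /basisP[zP zT] _] := indep_extend (@indep0 (restr P S)).
have zPP : indep P z.
  by move=> A; apply: leq_trans (zP A) _; apply/rk_mono/subsetIl.
have [b bP le_zb] := indep_extend zPP; exists b => //.
have /basisP[bI _] := bP; have := bI S; have := wt_le S le_zb.
have := zP (~: S); rewrite /= (setIC (~: S)) setICr rk0; move: zT; rewrite /= setTI.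
by have := wtC z S; lia.
Qed.

Lemma eq_bases_rk P Q : (forall b, basis P b <-> basis Q b) -> rk P =1 rk Q.
Proof.
move=> eqPQ S; apply/eqP; rewrite eqn_leq; apply/andP; split.
  have [b /eqPQ/basisP[bQ _] <-] := rk_attained P S; exact: bQ.
have [b /eqPQ/basisP[bP _] <-] := rk_attained Q S; exact: bP.
Qed.

Lemma basis_le_cage a P b : is_cage a P -> basis P b -> vle b a.
Proof.
move=> cP /basisP[bP _]; apply/forallP => i.
by rewrite -wt1; apply: leq_trans (bP _) (cP i).
Qed.

Lemma cage_wt a P S : is_cage a P -> P S <= wt a S.
Proof.
move=> cP; have [b bP <-] := rk_attained P S.
exact: wt_le (basis_le_cage cP bP).
Qed.

Definition psum P Q : polymatroid E.
Proof.
exists (fun A => P A + Q A).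
- by rewrite !rk0.
- by move=> A B sAB; apply: leq_add; apply: rk_mono.
- by move=> A B; have := rk_submod P A B; have := rk_submod Q A B; lia.
Defined.

(* contraction by one copy of i *)
Definition contr1 P i (Pi : 0 < P [set i]) : polymatroid E.
Proof.
exists (fun A => minn (P A) (P (i |: A)).-1).
- by rewrite rk0 min0n.
- move=> A B sAB; have := rk_mono P sAB.
  have := rk_mono P (setUS [set i] sAB); lia.
- move=> A B.
  have pos C : 0 < P (i |: C) by apply: leq_trans Pi (rk_mono _ (subsetUl _ _)).
  have s1 := rk_submod P A B.
  have s2 := rk_submod P (i |: A) (i |: B).
  have s3 := rk_submod P (i |: A) B.
  have s4 := rk_submod P A (i |: B).
  have sI C D : C :&: D \subset C :&: (i |: D) by apply/setIS/subsetUr.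
  have m3 := rk_mono P (sI B A); have m4 := rk_mono P (sI A B).
  rewrite -setUUr -setUIr in s2; rewrite -setUA (setIC (i |: A)) in s3.
  rewrite setUCA in s4; rewrite (setIC B A) in m3.
  move: (pos A) (pos B) (pos (A :|: B)) (pos (A :&: B)) => p1 p2 p3 p4.
  lia.
Defined.

Lemma psum_decomp P Q z : indep (psum P Q) z ->
  exists x y, [/\ indep P x, indep Q y & z = [ffun i => x i + y i]].
Proof.
move eq_n: (wt z setT) => n; elim: n z P Q eq_n => [|n IHn] z P Q eq_n zPQ.
  exists [ffun=> 0], [ffun=> 0]; split; [exact: indep0 | exact: indep0 |].
  apply/ffunP => i; rewrite !ffunE.
  by have := wtC z [set i]; rewrite wt1; lia.
have [i zi] : exists i, 0 < z i.
  case: (boolP [exists i, 0 < z i]) => [/existsP // | /existsPn nz].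
  move: eq_n; rewrite /wt big1 // => i _; have := nz i; lia.
pose d : {ffun E -> nat} := [ffun k => (k == i : nat)].
pose z' : {ffun E -> nat} := [ffun j => z j - d j].
have dz : vle d z.
  by apply/forallP => j; rewrite ffunE; case: eqP => [->|].
have wz' A : wt z' A = wt z A - (i \in A) by rewrite wt_compl // wt_delta.
have iz A : i \in A -> 0 < wt z A.
  by move=> iA; apply: leq_trans zi _; rewrite -wt1 wt_sub ?sub1set.
have zd x : z' = x -> z = [ffun j => x j + d j].
  move=> <-; apply/ffunP => j; have /forallP/(_ j) := dz.
  rewrite !ffunE; lia.
have cover (P1 : polymatroid E) x : forall Pi : 0 < P1 [set i],
    indep (@contr1 P1 i Pi) x -> indep P1 [ffun j => x j + d j].
  move=> Pi xP A; rewrite wtD wt_delta.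
  have := xP A => /=; have := rk_mono P1 (subsetUl [set i] A).
  case: (boolP (i \in A)) => iA; last by lia.
  have -> : i |: A = A by apply/setUidPr; rewrite sub1set.
  by lia.
pose good (P1 P2 : polymatroid E) := [forall S : {set E}, (i \notin S) ==> (wt z S < P1 (i |: S) + P2 S)].
have step (P1 P2 : polymatroid E) : indep (psum P1 P2) z -> good P1 P2 ->
    exists x y, [/\ indep P1 x, indep P2 y & z = [ffun j => x j + y j]].
  move=> zP12 /forallP gd.
  have Pi : 0 < P1 [set i].
    by have := gd set0; rewrite inE wt0 setU0 rk0; lia.
  have [||x [y [xP yP eqz]]] := IHn z' (@contr1 P1 i Pi) P2.
  - by rewrite wz' inE; lia.
  - move=> A; rewrite wz' /=.
    have := zP12 A => /=; have := gd A.
    case: (boolP (i \in A)) => iA; last by have := rk_mono P1 (subsetUl [set i] A); lia.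
    have -> : i |: A = A by apply/setUidPr; rewrite sub1set.
    by lia.
  - exists [ffun j => x j + d j], y; split=> //; first exact: cover xP.
    by rewrite (zd _ eqz); apply/ffunP => j; rewrite !ffunE addnAC.
case: (boolP (good P Q)) => [|/forallPn[S nS]]; first exact: step.
case: (boolP (good Q P)) => [|/forallPn[T nT]].
  case/step => [A|y [x [yQ xP eqz]]]; first by have := zPQ A; rewrite /= addnC.
  exists x, y; split=> //; rewrite eqz; apply/ffunP => j.
  by rewrite !ffunE addnC.
move: nS nT; rewrite !negb_imply -!leqNgt => /andP[niS leS] /andP[niT leT].
have s1 := rk_submod P (i |: S) T; have s2 := rk_submod Q S (i |: T).
have eqI1 : (i |: S) :&: T = S :&: T.
  by rewrite setIUl (_ : [set i] :&: T = set0) ?set0U //; apply/disjoint_setI0; rewrite disjoints1.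
have eqI2 : S :&: (i |: T) = S :&: T.
  rewrite setIUr (_ : S :&: [set i] = set0) ?set0U //.
  by rewrite setIC; apply/disjoint_setI0; rewrite disjoints1.
have := zPQ (i |: (S :|: T)); have := zPQ (S :&: T); rewrite /=.
have := wt_modular z S T; have := wt_modular z [set i] (S :|: T).
have -> : [set i] :&: (S :|: T) = set0.
  by apply/disjoint_setI0; rewrite disjoints1 inE negb_or niS.
rewrite wt0 wt1; move: s1 s2; rewrite eqI1 eqI2 -setUA setUCA; lia.
Qed.

Definition truncs a P S A := P (S :&: A) + wt a (S :\: A).

Definition trunc_rk a P S := truncs a P S [arg min_(A < set0) truncs a P S A].

Lemma trunc_rk_le a P S A : trunc_rk a P S <= truncs a P S A.
Proof. by rewrite /trunc_rk; case: arg_minnP => // B _; apply. Qed.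

Lemma trunc_rk_ex a P S : exists A, trunc_rk a P S = truncs a P S A.
Proof. by eexists. Qed.

Definition trunc a P : polymatroid E.
Proof.
exists (trunc_rk a P).
- apply/eqP; rewrite -leqn0; apply: leq_trans (trunc_rk_le a P set0 set0) _.
  by rewrite /truncs set0I set0D rk0 wt0.
- move=> A B sAB; have [C ->] := trunc_rk_ex a P B.
  apply: leq_trans (trunc_rk_le a P A C) _.
  by apply: leq_add; [apply/rk_mono/setSI | apply/wt_sub/setSD].
- move=> A B; have [C ->] := trunc_rk_ex a P A; have [D ->] := trunc_rk_ex a P B.
  pose U := (A :&: C) :|: (B :&: D); pose I := (A :&: C) :&: (B :&: D).
  have := trunc_rk_le a P (A :|: B) U; have := trunc_rk_le a P (A :&: B) I.
  rewrite /truncs.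
  have -> : (A :|: B) :&: U = U.
    by apply/setIidPr/setUSS; apply: subsetIl.
  have -> : (A :&: B) :&: I = I.
    by apply/setIidPr; rewrite /I setIACA subsetIl.
  have := rk_submod P (A :&: C) (B :&: D); rewrite -/U -/I.
  suff : wt a ((A :|: B) :\: U) + wt a ((A :&: B) :\: I) <=
         wt a (A :\: C) + wt a (B :\: D) by lia.
  rewrite /wt !(big_mkcond (fun i => i \in _)) -!big_split /=.
  apply: leq_sum => i _; rewrite !inE.
  by case: (i \in A); case: (i \in B); case: (i \in C); case: (i \in D);
    rewrite /=; lia.
Defined.

Lemma indep_trunc a P z : indep (trunc a P) z <-> indep P z /\ vle z a.
Proof.
split=> [zP | [zP za] A].
  split=> [A|].
    apply: leq_trans (zP A) _; apply: leq_trans (trunc_rk_le a P A A) _.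
    by rewrite /truncs setIid setDv wt0 addn0.
  apply/forallP => i; rewrite -wt1; apply: leq_trans (zP _) _.
  apply: leq_trans (trunc_rk_le a P [set i] set0) _.
  by rewrite /truncs setI0 rk0 setD0 wt1.
rewrite /=; have [B ->] := trunc_rk_ex a P A; rewrite (wtI z A B).
by apply: leq_add; [apply: zP | apply: wt_le].
Qed.

Lemma dual_bound a P S : is_cage a P -> P setT <= wt a S + P (~: S).
Proof.
move=> cP; have := rk_submod P S (~: S); have := cage_wt S cP.
by rewrite setUCr; lia.
Qed.

Definition dual a P (cP : is_cage a P) : polymatroid E.
Proof.
exists (fun S => wt a S + P (~: S) - P setT).
- by rewrite wt0 setC0; lia.
- move=> A B sAB.
  have bA := dual_bound A cP; have bB := dual_bound B cP.
  have := rk_submod P (~: B) (B :\: A).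
  have -> : ~: B :|: (B :\: A) = ~: A.
    apply/setP=> i; rewrite !inE; have := subsetP sAB i.
    by case: (i \in A) => [->|_] //=; case: (i \in B).
  have := cage_wt (B :\: A) cP.
  have := wtI a B A; rewrite (setIidPr sAB); lia.
- move=> A B.
  have := dual_bound A cP; have := dual_bound B cP.
  have := dual_bound (A :|: B) cP; have := dual_bound (A :&: B) cP.
  have := rk_submod P (~: A) (~: B); rewrite -setCI -setCU.
  have := wt_modular a A B; lia.
Defined.

Lemma dual_cage a P (cP : is_cage a P) : is_cage a (dual cP).
Proof.
move=> i /=; rewrite wt1.
have := rk_mono P (subsetT (~: [set i])); lia.
Qed.

Lemma dual_basis a P (cP : is_cage a P) b :
  basis P b -> basis (dual cP) [ffun i => a i - b i].
Proof.
move=> bP; have ba := basis_le_cage cP bP; have /basisP[bI bT] := bP.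
apply/basisP; split=> [A|]; rewrite wt_compl //=.
  by have := bI (~: A); have := wtC b A; have := wt_le A ba; lia.
by rewrite setCT rk0 bT; lia.
Qed.

Lemma dualK a P (cP : is_cage a P) : dual (dual_cage cP) =1 P.
Proof.
move=> S /=; rewrite setCK setCT rk0 (wtC a S).
have := dual_bound S cP; have := dual_bound (~: S) cP; rewrite setCK.
have := cage_wt setT cP; rewrite (wtC a S); have := rk_mono P (subsetT S).
lia.
Qed.

Lemma eq_rk_basis P Q b : P =1 Q -> basis P b -> basis Q b.
Proof. by move=> eqPQ [bT bP]; split=> [|A /bP]; rewrite -eqPQ. Qed.

Lemma complK a b : vle b a -> [ffun i => a i - [ffun j => a j - b j] i] = b.
Proof.
by move=> /forallP ba; apply/ffunP => i; rewrite !ffunE subKn.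
Qed.

Lemma dual_basisE a P (cP : is_cage a P) b :
  basis (dual cP) b <-> vle b a /\ basis P [ffun i => a i - b i].
Proof.
split=> [bD | [ba bP]].
  split; first exact: basis_le_cage (dual_cage cP) bD.
  by have := dual_basis (dual_cage cP) bD; apply/eq_rk_basis/dualK.
by rewrite -[b](complK ba); apply: dual_basis.
Qed.

Lemma vle_anti x y : vle x y -> vle y x -> x = y.
Proof.
by move=> xy yx; apply: vle_wt_eq xy _; apply: wt_le.
Qed.

Lemma vle_compl a x y : vle x y -> vle [ffun i => a i - y i] [ffun i => a i - x i].
Proof.
by move=> /forallP xy; apply/forallP => i; rewrite !ffunE leq_sub2l.
Qed.

Section Wedge.
Variables (a : {ffun E -> nat}) (P Q : cagedPolymatroid a).

Let T := trunc a (psum (dual (cageP P)) (dual (cageP Q))).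

Let T_cage : is_cage a T.
Proof.
move=> i; apply: leq_trans (trunc_rk_le _ _ _ set0) _.
by rewrite /truncs setI0 rk0 setD0 wt1.
Qed.

Let caps_le d : caps a P Q d -> vle d a.
Proof.
move=> [b [c [/(basis_le_cage (cageP P))/forallP ba]]].
move=> /(basis_le_cage (cageP Q))/forallP ca ->.
apply/forallP => i; rewrite ffunE; have := ba i; have := ca i; lia.
Qed.

Let caps_indep d : caps a P Q d -> indep T [ffun i => a i - d i].
Proof.
move=> [b [c [bP cQ ->]]].
have /forallP ba := basis_le_cage (cageP P) bP.
have /forallP ca := basis_le_cage (cageP Q) cQ.
have /basisP[bD _] := dual_basis (cageP P) bP.
have /basisP[cD _] := dual_basis (cageP Q) cQ.
apply/indep_trunc; split; last first.
  by apply/forallP => i; rewrite !ffunE leq_subr.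
pose s : {ffun E -> nat} :=
  [ffun i => [ffun i => a i - b i] i + [ffun i => a i - c i] i].
apply: (@indep_vle _ _ s).
  apply/forallP => i; rewrite !ffunE; have := ba i; have := ca i; lia.
by move=> A; rewrite wtD; apply: leq_add.
Qed.

Let indep_caps t : indep T t ->
  exists2 d, caps a P Q d & vle d [ffun i => a i - t i].
Proof.
move=> /indep_trunc[/psum_decomp[x [y [xP yQ ->]]] /forallP ta].
have [x' /dual_basisE[/forallP xa bx] /forallP le_x] := indep_extend xP.
have [y' /dual_basisE[/forallP ya cy] /forallP le_y] := indep_extend yQ.
exists (cap a [ffun i => a i - x' i] [ffun i => a i - y' i]).
  by exists [ffun i => a i - x' i], [ffun i => a i - y' i].
apply/forallP => i; rewrite !ffunE.
have := le_x i; have := le_y i; have := xa i; have := ya i; lia.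
Qed.

Lemma wedge_exists : {R : cagedPolymatroid a |
  forall d, basis R d <-> minimal_in (caps a P Q) d}.
Proof.
exists (Caged (dual_cage T_cage)) => d /=; rewrite dual_basisE.
split=> [[da dT] | [dX dmin]].
  have /basisP[dI dTT] := dT.
  have [c cX cd] := indep_caps dI; rewrite complK // in cd.
  have uniq e : caps a P Q e -> vle e d -> e = d.
    move=> eX ed; have ea := caps_le eX.
    suff eq_de : [ffun i => a i - d i] = [ffun i => a i - e i].
      by rewrite -[e](complK ea) -eq_de complK.
    apply: vle_wt_eq; first exact: vle_compl.
    by rewrite dTT; apply: caps_indep.
  by split=> //; rewrite -(uniq c).
have da := caps_le dX; split=> //.
have [t tT le_t] := indep_extend (caps_indep dX).
have /basisP[tI _] := tT; have [e eX le_e] := indep_caps tI.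
have ta := basis_le_cage T_cage tT.
have le_td : vle [ffun i => a i - t i] d.
  by rewrite -[d in vle _ d](complK da); apply: vle_compl.
have ed := dmin e eX (vle_trans le_e le_td).
suff <- : t = [ffun i => a i - d i] by [].
apply: vle_anti => //; rewrite -[t](complK ta).
by apply: vle_compl; rewrite -ed.
Qed.

(** [P /\_a Q]: the polymatroid whose bases are the minimal elements of
    [caps a P Q]; by [eq_bases_rk] its rank function is determined by this. *)
Definition wedge : cagedPolymatroid a := sval wedge_exists.

Lemma basis_wedge d : basis wedge d <-> minimal_in (caps a P Q) d.
Proof. exact: (svalP wedge_exists). Qed.

End Wedge.
End Theory.

(** * Direct sums, Boolean polymatroids, deletion *)

(** The disjoint union of the ground sets is the sum type [E1 + E2]. *)
Definition cage_sum (E1 E2 : finType) (a : {ffun E1 -> nat})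
    (b : {ffun E2 -> nat}) : {ffun E1 + E2 -> nat} :=
  [ffun s => match s with inl i => a i | inr j => b j end].

Definition direct_sum (E1 E2 : finType) (P : polymatroid E1)
  (Q : polymatroid E2) : polymatroid (E1 + E2)%type.
Proof.
exists (fun S : {set E1 + E2} =>
  P [set i | inl i \in S] + Q [set j | inr j \in S]).
- have -> : [set i : E1 | inl i \in @set0 (E1 + E2)%type] = set0.
    by apply/setP => i; rewrite !inE.
  have -> : [set j : E2 | inr j \in @set0 (E1 + E2)%type] = set0.
    by apply/setP => j; rewrite !inE.
  by rewrite !rk0.
- move=> A B /subsetP sAB; apply: leq_add; apply: rk_mono; apply/subsetP => i;
    by rewrite !inE => /sAB.
- move=> A B.
  have := rk_submod P [set i | inl i \in A] [set i | inl i \in B].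
  have := rk_submod Q [set j | inr j \in A] [set j | inr j \in B].
  have -> : [set i | inl i \in A] :|: [set i | inl i \in B] =
            [set i | inl i \in A :|: B] by apply/setP => i; rewrite !inE.
  have -> : [set i | inl i \in A] :&: [set i | inl i \in B] =
            [set i | inl i \in A :&: B] by apply/setP => i; rewrite !inE.
  have -> : [set i | inr i \in A] :|: [set i | inr i \in B] =
            [set i | inr i \in A :|: B] by apply/setP => i; rewrite !inE.
  have -> : [set i | inr i \in A] :&: [set i | inr i \in B] =
            [set i | inr i \in A :&: B] by apply/setP => i; rewrite !inE.
  lia.
Defined.

Lemma direct_sum_cage (E1 E2 : finType) (a : {ffun E1 -> nat})
    (b : {ffun E2 -> nat}) (P : cagedPolymatroid a) (Q : cagedPolymatroid b) :
  is_cage (cage_sum a b) (direct_sum P Q).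
Proof.
move=> [k|k]; rewrite ffunE /=.
  have -> : [set i : E1 | inl i \in [set inl k : E1 + E2]] = [set k].
    by apply/setP => i; rewrite !inE.
  have -> : [set j : E2 | inr j \in [set inl k : E1 + E2]] = set0.
    by apply/setP => i; rewrite !inE.
  by rewrite rk0 addn0; apply: cageP.
have -> : [set j : E2 | inr j \in [set inr k : E1 + E2]] = [set k].
  by apply/setP => i; rewrite !inE.
have -> : [set i : E1 | inl i \in [set inr k : E1 + E2]] = set0.
  by apply/setP => i; rewrite !inE.
by rewrite rk0; apply: cageP.
Qed.

Definition caged_sum (E1 E2 : finType) (a : {ffun E1 -> nat})
    (b : {ffun E2 -> nat}) (P : cagedPolymatroid a) (Q : cagedPolymatroid b) :
    cagedPolymatroid (cage_sum a b) :=
  Caged (direct_sum_cage P Q).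

Definition boolean_pm (E : finType) (b : {ffun E -> nat}) : polymatroid E.
Proof.
exists (fun S => wt b S); first exact: wt0.
- exact: wt_sub.
- by move=> A B; rewrite wt_modular.
Defined.

Lemma boolean_cage (E : finType) (b : {ffun E -> nat}) :
  is_cage b (boolean_pm b).
Proof. by move=> i /=; rewrite wt1. Qed.

Definition boolean (E : finType) (b : {ffun E -> nat}) : cagedPolymatroid b :=
  Caged (boolean_cage b).

(** Deletion of the summand [E1]; the remaining ground set [(E1 + E2) \ E1] is
    identified with [E2] along [inr]. *)
Definition delete_left (E1 E2 : finType) (P : polymatroid (E1 + E2)%type) :
  polymatroid E2.
Proof.
exists (fun S : {set E2} => P (inr @: S)).
- by rewrite imset0 rk0.
- by move=> A B sAB; apply/rk_mono/imsetS.
- move=> A B; rewrite imsetU imsetI; first exact: rk_submod.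
  by move=> x y _ _ [].
Defined.

Lemma delete_left_cage (E1 E2 : finType) (a : {ffun E1 -> nat})
    (b : {ffun E2 -> nat}) (P : cagedPolymatroid (cage_sum a b)) :
  is_cage b (delete_left P).
Proof.
move=> j; rewrite /= imset_set1; apply: leq_trans (cageP P (inr j)) _.
by rewrite ffunE.
Qed.

Definition caged_delete_left (E1 E2 : finType) (a : {ffun E1 -> nat})
    (b : {ffun E2 -> nat}) (P : cagedPolymatroid (cage_sum a b)) :
    cagedPolymatroid b :=
  Caged (delete_left_cage P).

Definition correspondence (E1 E2 : finType) (a : {ffun E1 -> nat})
    (b : {ffun E2 -> nat}) (C : cagedPolymatroid (cage_sum a b))
    (P : cagedPolymatroid a) : cagedPolymatroid b :=
  caged_delete_left (wedge (caged_sum P (boolean b)) C).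

(** * Algebraic polymatroids *)

Local Open Scope ring_scope.

(** [iota] embeds [K] in [L]; a subfield of [L] is given by its membership
    predicate. *)
Section Transcendence.
Variables (K L : fieldType) (iota : {rmorphism K -> L}).
Implicit Types (F U : L -> Prop).

Definition intermediate_field F :=
  [/\ forall c, F (iota c),
      forall x y, F x -> F y -> F (x - y),
      forall x y, F x -> F y -> F (x * y)
    & forall x, F x -> F x^-1].

(* K(U) *)
Definition adjoin U x :=
  forall F, intermediate_field F -> (forall y, U y -> F y) -> F x.

Definition algebraic_over F x :=
  exists p : {poly L}, [/\ p != 0, forall k, F p`_k & root p x].

Definition alg_independent d (t : 'I_d -> L) :=
  forall p : {mpoly K[d]}, mmap iota t p = 0 -> p = 0.

(** [F] has transcendence degree [d] over [K]: it has a transcendence basis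
    with [d] elements. *)
Definition has_trdeg F d :=
  exists t : 'I_d -> L,
    [/\ forall i, F (t i), alg_independent t &
        forall x, F x -> algebraic_over (adjoin (fun y => exists i, y = t i)) x].

End Transcendence.

Definition algebraic (K : fieldType) (E : finType) (P : polymatroid E) :=
  exists (L : fieldType) (iota : {rmorphism K -> L}) (F : E -> L -> Prop),
    (forall i, intermediate_field iota (F i)) /\
    forall S : {set E},
      has_trdeg iota (adjoin iota (fun x => exists2 i, i \in S & F i x)) (P S).

(* Main.v *)
From HB Require Import structures.
From mathcomp Require Import all_boot all_order all_algebra all_field.
From mathcomp Require Import boolp mpoly zify ring.
Require Import Defs.

Set Implicit Arguments.
Unset Strict Implicit.
Unset Printing Implicit Defensive.

Import GRing.Theory.

(** Why correspondences preserve algebraicity.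

    Write [r] for transcendence degree over [K]. Unwinding the definition of the
    wedge through duals and truncations, with
    [g S] the minimum over [A] of [P A + C (A, S) + wt a (~: A)], one finds
    [correspondence C P S = g S - g set0] ([correspondence_rank]). It remains to
    realize this number as a transcendence degree.

    - Represent [P] and [C] by finite lists of elements [p i], [c (inl i)],
      [c (inr j)] of one extension [L] of [K], with the [p i] algebraically free
      from the [c k], so that the ranks add ([algebraic_direct_sum]).
    - For every [i] choose [a i] elements in general position in the algebraic
      closure of [p i] and [c (inl i)]. By a theorem of Rado's type
      ([generic_elements]) their list [t] satisfies
      [r (t, c (inr j) for j in S) = g S]. So the degree over [K(t)] of the
      elements [c (inr j)], [j] in [S], is [g S - g set0].
    - Finally replace the ground field [K(t)] by [K], by specializing
      [t] to elements algebraic over [K] ([transfer]).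

    Specialization also yields the first step, and is the heart of the matter.
    Let [x] be a finite family in [L] and [b] a transcendence basis of it over
    [K(t)]. Send [t] to algebraic elements and [b] to indeterminates, and extend
    this to [x] one element at a time by taking roots of minimal relations; each
    extension only asks for some element of the ring constructed so far not to
    be killed ([specialize_closed], [specialize_generic]). For every
    dependence [x_i] on [x_S] keep one coefficient of a relation nonzero:
    then all dependences persist, so no rank goes up. The total rank does
    not go down, since [b] stays independent; by the chain rule for ranks no
    rank changes at all.

    Transcendence degree is handled as the rank of a pregeometry, counted
    greedily along lists ([rks]). *)

(** * Rank in a pregeometry *)

Definition addp (T : eqType) (U : T -> Prop) (s : seq T) : T -> Prop :=
  fun z => U z \/ z \in s.

(** Monotonicity and idempotence are packed together in [cl_trans]. *)
Record pregeometry (T : eqType) (cl : (T -> Prop) -> T -> Prop) : Prop :=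
  Pregeometry {
    cl_ext : forall U x, U x -> cl U x;
    cl_trans : forall U V x, (forall z, U z -> cl V z) -> cl U x -> cl V x;
    cl_exch : forall U x y,
      cl (addp U [:: y]) x -> ~ cl U x -> cl (addp U [:: x]) y }.

(** The greedy rank of [s] over [U]: each entry counts unless the earlier ones
    and [U] already span it. With this definition the chain rule [rks_cat] is
    immediate, and independence of the order is what exchange has to give. *)
Fixpoint rks (T : eqType) (cl : (T -> Prop) -> T -> Prop) (U : T -> Prop)
    (s : seq T) : nat :=
  if s is y :: s' then ~~ `[< cl U y >] + rks cl (addp U [:: y]) s' else 0.

Section Rank.
Variables (T : eqType) (cl : (T -> Prop) -> T -> Prop).
Hypothesis clP : pregeometry cl.
Implicit Types (U V : T -> Prop) (s t : seq T).
Local Notation rk := (rks cl).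

Lemma cl_mono U V x : (forall z, U z -> V z) -> cl U x -> cl V x.
Proof. by move=> sUV; apply: (cl_trans clP) => z /sUV; apply: cl_ext. Qed.

Lemma cl_addp U V s x : (forall z, U z -> cl V z) -> cl (addp U s) x ->
  cl (addp V s) x.
Proof.
move=> sUV; apply: (cl_trans clP) => z [/sUV|zs].
  by apply: cl_mono => ?; left.
by apply: (cl_ext clP); right.
Qed.

Lemma cl_in U s x : x \in s -> cl (addp U s) x.
Proof. by move=> xs; apply: (cl_ext clP); right. Qed.

Lemma rks_le U V s : (forall z, U z -> cl V z) -> rk V s <= rk U s.
Proof.
elim: s U V => //= y s IHs U V sUV; apply: leq_add.
  case: asboolP => //= nVy; case: asboolP => // Uy; case: nVy.
  exact: (cl_trans clP) Uy.
apply: IHs => z [/sUV|]; first by apply: cl_mono => ?; left.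
exact: cl_in.
Qed.

Lemma rks_eq U V s : (forall z, U z -> cl V z) -> (forall z, V z -> cl U z) ->
  rk U s = rk V s.
Proof. by move=> sUV sVU; apply/eqP; rewrite eqn_leq !rks_le. Qed.

Lemma rks_ext U V s : (forall z, U z <-> V z) -> rk U s = rk V s.
Proof. by move=> eqUV; apply: rks_eq => z /eqUV; apply: (cl_ext clP). Qed.

Lemma addp_cat U s t z : addp (addp U s) t z <-> addp U (s ++ t) z.
Proof.
rewrite /addp mem_cat; split=> [[[Uz|zs]|zt]|[Uz|/orP[zs|zt]]].
- by left.
- by right; rewrite zs.
- by right; rewrite zt orbT.
- by left; left.
- by left; right.
- by right.
Qed.

Lemma addp_catC U s t z : addp U (s ++ t) z <-> addp U (t ++ s) z.
Proof. by rewrite /addp !mem_cat orbC. Qed.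

Lemma rks_cat U s t : rk U (s ++ t) = rk U s + rk (addp U s) t.
Proof.
elim: s U => [|y s IHs] U /=.
  by rewrite add0n; apply: rks_ext => z; split; [left | case].
by rewrite IHs addnA; congr (_ + _); apply: rks_ext => z; apply: addp_cat.
Qed.

Lemma rks0P U s : (forall z, z \in s -> cl U z) -> rk U s = 0.
Proof.
elim: s U => //= y s IHs U sU.
have -> : `[< cl U y >] by apply/asboolP/sU/mem_head.
rewrite add0n; apply: IHs => z zs; apply: cl_mono (sU z _); first by left.
by rewrite inE zs orbT.
Qed.

Lemma rks_size U s : rk U s <= size s.
Proof.
elim: s U => //= y s IHs U; rewrite -add1n; apply: leq_add => //.
by case: `[< _ >].
Qed.

(** This is the exchange axiom; all invariance of the rank follows from it. *)
Lemma rks_swap U x y : rk U [:: x; y] = rk U [:: y; x].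
Proof.
rewrite /= !addn0.
have ex u v := @cl_exch T cl clP U u v.
have mo u v : cl U u -> cl (addp U [:: v]) u by apply: cl_mono => ?; left.
have ab u v : cl U v -> cl (addp U [:: v]) u -> cl U u.
  move=> Uv; apply: (cl_trans clP) => z [?|/[1!inE]/eqP-> //].
  exact: (cl_ext clP).
have := ex x y; have := ex y x; have := mo x y; have := mo y x.
have := ab x y; have := ab y x.
by (do 4 case: asboolP) => //=; tauto.
Qed.

Lemma rks_cons U y s : rk U (y :: s) = rk U (s ++ [:: y]).
Proof.
elim: s U => // x s IHs U.
have -> : rk U [:: y, x & s] = rk U ([:: y; x] ++ s) by [].
rewrite rks_cat rks_swap (@rks_ext (addp U [:: y; x]) (addp U [:: x; y])); last first.
  exact: (addp_catC U [:: y] [:: x]).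
by rewrite -rks_cat /= -IHs.
Qed.

Lemma rks_catC U s t : rk U (s ++ t) = rk U (t ++ s).
Proof.
elim: s t => [|x s IHs] t; first by rewrite cats0.
by rewrite cat_cons rks_cons -catA IHs -catA.
Qed.

(** The greedy rank of a list is at most that of any list spanning it: append
    the spanning list, which by symmetry can be counted first. *)
Lemma rks_span U s t : (forall z, z \in s -> cl (addp U t) z) -> rk U s <= rk U t.
Proof.
move=> st; have := rks_cat U t s; rewrite (rks0P st) addn0 => <-.
by rewrite rks_catC rks_cat leq_addr.
Qed.

Lemma rks_sub U s t : {subset s <= t} -> rk U s <= rk U t.
Proof. by move=> st; apply: rks_span => z /st; apply: cl_in. Qed.

(** The entries that the greedy rank counts form a basis. *)
Lemma rks_basis U s : exists b,
  [/\ {subset b <= s}, rk U b = size b, size b = rk U s &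
      forall z, z \in s -> cl (addp U b) z].
Proof.
elim: s U => [|y s IHs] U; first by exists [::].
have [b [sb ib rb cb]] := IHs (addp U [:: y]); rewrite /=.
have reb z : cl (addp (addp U [:: y]) b) z -> cl (addp U (y :: b)) z.
  by apply: cl_mono => u /(addp_cat U [:: y] b u).
case: asboolP => yU /=.
  exists b; split=> [z /sb|||z]; rewrite ?inE.
  - by move=> ->; rewrite orbT.
  - rewrite -ib; apply: rks_eq => z Uz; last first.
      by case: Uz => [?|/[1!inE]/eqP-> //]; apply: (cl_ext clP).
    by apply: (cl_ext clP); left.
  - exact: rb.
  - have mo u : cl (addp (addp U [:: y]) b) u -> cl (addp U b) u.
      apply: cl_addp => v [?|/[1!inE]/eqP-> //]; exact: (cl_ext clP).
    case/orP => [/eqP->|/cb/mo //].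
    by apply: cl_mono yU => v; left.
exists (y :: b); split=> [z|||z]; rewrite ?inE.
- by case/orP=> [->|/sb->] //; rewrite orbT.
- by rewrite /= ib; case: asboolP.
- by rewrite /= rb.
- case/orP => [/eqP->|/cb/reb //]; apply: cl_in; exact: mem_head.
Qed.

End Rank.

(** * The rank function of a correspondence *)

Section Wedge.
Variables (E : finType) (a : {ffun E -> nat}) (P Q : cagedPolymatroid a).
Implicit Types (d t : {ffun E -> nat}) (S X Y : {set E}).

(** Complements in the cage turn [max (b + c - a, 0)] into the truncation to [a]
    of the sum of the complements of [b] and [c]. Hence the wedge is dual to the
    truncation of [dual_sum]. *)
Definition dual_sum := psum (dual (cageP P)) (dual (cageP Q)).

Lemma caps_le_cage d : caps a P Q d -> vle d a.
Proof.
move=> [b [c [/(basis_le_cage (cageP P))/forallP ba]]].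
move=> /(basis_le_cage (cageP Q))/forallP ca ->.
by apply/forallP => i; rewrite ffunE; have := ba i; have := ca i; lia.
Qed.

Lemma caps_indep d : caps a P Q d -> indep (trunc a dual_sum) [ffun i => a i - d i].
Proof.
move=> [b [c [bP cQ ->]]].
have /forallP ba := basis_le_cage (cageP P) bP.
have /forallP ca := basis_le_cage (cageP Q) cQ.
have /basisP[bD _] := dual_basis (cageP P) bP.
have /basisP[cD _] := dual_basis (cageP Q) cQ.
apply/indep_trunc; split; last by apply/forallP => i; rewrite !ffunE leq_subr.
apply: (@indep_vle _ _ _ [ffun i => [ffun i => a i - b i] i + [ffun i => a i - c i] i]).
  by apply/forallP => i; rewrite !ffunE; have := ba i; have := ca i; lia.
by move=> A; rewrite wtD; apply: leq_add.
Qed.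

Lemma indep_caps t : indep (trunc a dual_sum) t ->
  exists2 d, caps a P Q d & vle d [ffun i => a i - t i].
Proof.
move=> /indep_trunc[/psum_decomp[x [y [xP yQ ->]]] /forallP ta].
have [x' /dual_basisE[/forallP xa bx] /forallP le_x] := indep_extend xP.
have [y' /dual_basisE[/forallP ya cy] /forallP le_y] := indep_extend yQ.
exists (cap a [ffun i => a i - x' i] [ffun i => a i - y' i]).
  by exists [ffun i => a i - x' i], [ffun i => a i - y' i].
apply/forallP => i; rewrite !ffunE.
by have := le_x i; have := le_y i; have := xa i; have := ya i; lia.
Qed.

Lemma basis_caps_minimal t d : basis (trunc a dual_sum) t -> caps a P Q d ->
  vle d [ffun i => a i - t i] -> d = [ffun i => a i - t i].
Proof.
move=> tT dX le_d; have /basisP[tI tE] := tT; have da := caps_le_cage dX.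
have /indep_trunc[_ ta] := tI.
suff <- : [ffun i => a i - d i] = t by rewrite complK.
apply/esym/vle_wt_eq; first by rewrite -[t](complK ta); apply: vle_compl.
by rewrite tE; apply: caps_indep.
Qed.

(** The wedge is only given by its bases. These are the complements in [a] of
    the bases of [trunc a dual_sum], so the formula is that of a dual rank; both
    inequalities come from a basis that attains the rank of a set. *)
Lemma wedge_rank S :
  wedge P Q S + trunc a dual_sum setT = wt a S + trunc a dual_sum (~: S).
Proof.
apply/eqP; rewrite eqn_leq; apply/andP; split.
  have [d /basis_wedge[dX dmin] <-] := rk_attained (wedge P Q) S.
  have [t tT le_t] := indep_extend (caps_indep dX); have /basisP[tI tE] := tT.
  have /indep_trunc[_ ta] := tI; have [e eX le_e] := indep_caps tI.
  have le_td : vle [ffun i => a i - t i] d.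
    by rewrite -[d in vle _ d](complK (caps_le_cage dX)); apply: vle_compl.
  have dE : d = [ffun i => a i - t i].
    rewrite -(dmin e eX (vle_trans le_e le_td)); exact: basis_caps_minimal le_e.
  have := wt_le S ta; have := tI (~: S); have := wtC t S.
  by rewrite -tE dE wt_compl //; lia.
have [t tT tS] := rk_attained (trunc a dual_sum) (~: S).
have /basisP[tI tE] := tT; have /indep_trunc[_ ta] := tI.
have [d dX le_d] := indep_caps tI; have dE := basis_caps_minimal tT dX le_d.
have /basisP[dI _] : basis (wedge P Q) d.
  apply/basis_wedge; split=> // e eX le_e; rewrite dE; apply: basis_caps_minimal => //.
  by apply: vle_trans le_e _; rewrite dE vle_refl.
have := dI S; have := wt_le S ta; have := wtC t S.
by rewrite -tE -tS dE wt_compl //; lia.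
Qed.

Lemma truncs_dual_sum X Y : truncs a dual_sum X Y + (P setT + Q setT) =
  wt a X + wt a (X :&: Y) + P (~: (X :&: Y)) + Q (~: (X :&: Y)).
Proof.
rewrite /truncs /=; have := dual_bound (X :&: Y) (cageP P).
by have := dual_bound (X :&: Y) (cageP Q); have := wtI a X Y; lia.
Qed.
End Wedge.

Lemma wt_cage_sum (E1 E2 : finType) (a : {ffun E1 -> nat}) (b : {ffun E2 -> nat}) Y :
  wt (cage_sum a b) Y = wt a [set i | inl i \in Y] + wt b [set j | inr j \in Y].
Proof.
rewrite /wt big_sumType; congr (_ + _); apply: eq_big => i; rewrite ?inE //;
  by rewrite ffunE.
Qed.

(** The two hypotheses say that [g S] is the minimum over [A] of
    [P A + C (A, S) + wt a (~: A)]. The truncation in [wedge_rank] is a minimum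
    over the sets containing [S]; as [C] is monotone and the summand on [E2] is
    Boolean, only those sets matter whose part in [E2] is [S] itself. *)
Lemma correspondence_rank (E1 E2 : finType) (a : {ffun E1 -> nat})
    (b : {ffun E2 -> nat}) (C : cagedPolymatroid (cage_sum a b))
    (P : cagedPolymatroid a) (g : {set E2} -> nat) :
  (forall (S : {set E2}) (A : {set E1}), g S <= P A + C (inl @: A :|: inr @: S) + wt a (~: A)) ->
  (forall S : {set E2}, exists A : {set E1},
     P A + C (inl @: A :|: inr @: S) + wt a (~: A) <= g S) ->
  forall S, correspondence C P S + g set0 = g S.
Proof.
move=> g_le g_ge S; pose PB := caged_sum P (boolean b).
pose c := PB setT + C setT; pose T := trunc (cage_sum a b) (dual_sum PB C).
have partl (A : {set E1}) (B : {set E2}) :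
    [set i | inl i \in (inl @: A :|: inr @: B : {set E1 + E2})] = A.
  apply/setP => i; rewrite !inE mem_imset; last by move=> x y [].
  by case: (_ \in A) => //=; apply/imsetP => -[].
have partr (A : {set E1}) (B : {set E2}) :
    [set i | inr i \in (inl @: A :|: inr @: B : {set E1 + E2})] = B.
  apply/setP => i; rewrite !inE orbC mem_imset; last by move=> x y [].
  by case: (_ \in B) => //=; apply/imsetP => -[].
have setCl (Y : {set E1 + E2}) : [set i | inl i \in ~: Y] = ~: [set i | inl i \in Y].
  by apply/setP => i; rewrite !inE.
have setCr (Y : {set E1 + E2}) : [set i | inr i \in ~: Y] = ~: [set i | inr i \in Y].
  by apply/setP => i; rewrite !inE.
have TE (U : {set E2}) : T (~: (inr @: U)) + c =
    wt (cage_sum a b) (~: (inr @: U)) + g U + wt b setT.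
  set X := ~: _; apply/eqP; rewrite eqn_leq; apply/andP; split.
    have [A leA] := g_ge U; set B := _ :|: _ in leA.
    have XB : X :&: ~: B = ~: B by apply/setIidPr; rewrite setCS subsetUr.
    have := trunc_rk_le (cage_sum a b) (dual_sum PB C) X (~: B).
    have := truncs_dual_sum PB C X (~: B); rewrite -/c XB setCK /=.
    rewrite (wt_cage_sum a b (~: B)) setCl setCr; move: leA.
    by rewrite /B !partl !partr (wtC b U) /T /=; lia.
  have [Y] := trunc_rk_ex (cage_sum a b) (dual_sum PB C) X; rewrite /T /= => ->.
  rewrite truncs_dual_sum; set B' := ~: (X :&: Y).
  have : wt (cage_sum a b) (X :&: Y) = wt (cage_sum a b) (~: B') by rewrite setCK.
  rewrite (wt_cage_sum a b (~: B')) setCl setCr => ->.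
  have := g_le U [set i | inl i \in B'].
  set D := _ :|: _; have : D \subset B'.
    rewrite subUset; apply/andP; split.
      by apply/subsetP => _ /imsetP[i + ->]; rewrite inE.
    by rewrite /B' setCI /X setCK subsetUl.
  move/(rk_mono C).
  have -> : PB B' = P [set i | inl i \in B'] + wt b [set j | inr j \in B'] by [].
  rewrite (wtC b [set j | inr j \in B']).
  move: (wt b _) (wt b (~: _)) (wt a (~: _)) (C D) (C B') (P _) (wt _ X) (g U).
  lia.
have := wedge_rank PB C (inr @: S); have := TE S; have := TE set0.
rewrite imset0 setC0 (wtC _ (inr @: S)) /T /= -/PB; set X := [set _ | _ in _].
move: (wedge _ _ X) (wt _ X) (wt _ (~: X)) (wt b _) (trunc_rk _ _ setT).
move: (trunc_rk _ _ (~: X)) (g S) (g set0); lia.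
Qed.

Local Open Scope ring_scope.

(** * Algebraic closure is a pregeometry *)

(** Subfields of [L] come as predicates. Turning them into types gives access to
    polynomials and integrality over them. *)
Section Subfield.
Variables (K L : fieldType) (iota : {rmorphism K -> L}) (F : L -> Prop).
Hypothesis hF : intermediate_field iota F.

(** The hypothesis is an argument so that inference can recover it from the
    predicate. *)
Definition fieldp of intermediate_field iota F : {pred L} := fun x => `[< F x >].

Fact fieldp_closed : divring_closed (fieldp hF).
Proof.
case: hF => Fc FB FM FV; split=> [|x y /asboolP Fx /asboolP Fy|x y /asboolP Fx /asboolP Fy];
  apply/asboolP.
- by rewrite -(rmorph1 iota).
- exact: FB.
- exact: (FM _ _ Fx (FV _ Fy)).
Qed.
HB.instance Definition _ := GRing.isDivringClosed.Build L (fieldp hF) fieldp_closed.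

Record subfield := Subfield { subval :> L; subvalP : subval \in fieldp hF }.
HB.instance Definition _ := [isSub for subval].
HB.instance Definition _ := [Choice of subfield by <:].
HB.instance Definition _ := [SubChoice_isSubIntegralDomain of subfield by <:].
HB.instance Definition _ := [SubIntegralDomain_isSubField of subfield by <:].

Lemma subval_is_zmod_morphism : zmod_morphism subval. Proof. by []. Qed.
Lemma subval_is_monoid_morphism : monoid_morphism subval. Proof. by []. Qed.
HB.instance Definition _ := GRing.isZmodMorphism.Build subfield L subval
  subval_is_zmod_morphism.
HB.instance Definition _ := GRing.isMonoidMorphism.Build subfield L subval
  subval_is_monoid_morphism.

Lemma subfieldP (x : subfield) : F (subval x).
Proof. exact/asboolP/subvalP. Qed.

Lemma subfield_lift x : F x -> exists y : subfield, subval y = x.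
Proof. by move=> /asboolP Fx; exists (@Subfield x Fx). Qed.

Lemma poly_lift (p : {poly L}) : (forall k, F p`_k) ->
  exists q : {poly subfield}, map_poly subval q = p.
Proof.
move=> Fp; have /choice[f fE] k := subfield_lift (Fp k).
exists (\poly_(i < size p) f i); apply/polyP => i.
rewrite coef_map coef_poly -(fE i); case: ltnP => // /(nth_default 0) p0.
by rewrite fE p0.
Qed.

Lemma algebraic_subfield x : algebraic_over F x <-> algebraicOver subval x.
Proof.
split=> [[p [p0 Fp px]]|[q q0 qx]].
  have [q qE] := poly_lift Fp; exists q; last by rewrite qE.
  by apply: contraNneq p0 => q0; rewrite -qE q0 rmorph0.
exists (map_poly subval q); split=> //; first by rewrite map_poly_eq0.
by move=> k; rewrite coef_map; apply: subfieldP.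
Qed.

Lemma algebraic_over_field : intermediate_field iota (algebraic_over F).
Proof.
split=> [c|x y|x y|x]; rewrite ?algebraic_subfield.
- have [Fc _ _ _] := hF; have [y <-] := subfield_lift (Fc c).
  exact: algebraic_id.
- exact: algebraic_sub.
- exact: algebraic_mul.
- exact: algebraic_inv.
Qed.

Lemma algebraic_over_id x : F x -> algebraic_over F x.
Proof.
by move=> /subfield_lift[y <-]; apply/algebraic_subfield/algebraic_id.
Qed.

(** After division by its leading coefficient a relation is monic with integral
    coefficients. *)
Lemma algebraic_over_trans x :
  algebraic_over (algebraic_over F) x -> algebraic_over F x.
Proof.
move=> [p [p0 Fp px]]; apply/algebraic_subfield/integral_algebraic.
have [_ _ FM FV] := algebraic_over_field.
have l0 : lead_coef p != 0 by rewrite lead_coef_eq0.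
apply: (@integral_root_monic _ _ _ _ ((lead_coef p)^-1 *: p)).
- by apply/monicP; rewrite lead_coefZ mulVf.
- by rewrite rootZ ?invr_eq0.
- move=> _ /(nthP 0)[i _ <-]; rewrite coefZ.
  by apply/integral_algebraic/algebraic_subfield/FM => //; apply: FV; apply: Fp.
Qed.

End Subfield.

Section Closure.
Variables (K L : fieldType) (iota : {rmorphism K -> L}).
Implicit Types (U V : L -> Prop).

Definition acl U : L -> Prop := algebraic_over (adjoin iota U).

Lemma adjoin_field U : intermediate_field iota (adjoin iota U).
Proof.
split=> [c F [Fc _ _ _] _ | x y Ux Uy F hF sUF | x y Ux Uy F hF sUF | x Ux F hF sUF].
- exact: Fc.
- by case: (hF) => _ FB _ _; apply: FB; [apply: Ux | apply: Uy].
- by case: (hF) => _ _ FM _; apply: FM; [apply: Ux | apply: Uy].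
- by case: (hF) => _ _ _ FV; apply: FV; apply: Ux.
Qed.

Lemma adjoin_ext U x : U x -> adjoin iota U x.
Proof. by move=> Ux F _; apply. Qed.

Lemma acl_field U : intermediate_field iota (acl U).
Proof. exact: (algebraic_over_field (adjoin_field U)). Qed.

Lemma acl_adjoin U x : adjoin iota U x -> acl U x.
Proof. exact: (algebraic_over_id (adjoin_field U)). Qed.

Lemma acl_ext U x : U x -> acl U x.
Proof. by move=> Ux; apply: acl_adjoin; apply: adjoin_ext. Qed.

Lemma algebraic_over_mono U V x :
  (forall z, U z -> V z) -> algebraic_over U x -> algebraic_over V x.
Proof. by move=> sUV [p [p0 Up px]]; exists p; split=> // k; apply: sUV. Qed.

Lemma adjoin_min U F x : intermediate_field iota F -> (forall z, U z -> F z) ->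
  adjoin iota U x -> F x.
Proof. by move=> hF sUF; apply. Qed.

Lemma acl_trans U V x : (forall z, U z -> acl V z) -> acl U x -> acl V x.
Proof.
move=> sUV Ux; apply: (algebraic_over_trans (adjoin_field V)).
apply: algebraic_over_mono Ux => z; apply: adjoin_min sUV; exact: acl_field.
Qed.

(** [G] is any ring of expressions for the elements of [K] and [U], such as a
    polynomial ring; the fractions of their values form a field. *)
Lemma adjoin_frac (G : comNzRingType) (ev : {rmorphism G -> L}) U z :
    (forall c, exists g, ev g = iota c) -> (forall y, U y -> exists g, ev g = y) ->
  adjoin iota U z -> exists n d, ev d != 0 /\ z = ev n / ev d.
Proof.
move=> evK evU; pose F z := exists n d, ev d != 0 /\ z = ev n / ev d.
apply: (@adjoin_min U F) => [|y /evU[g <-]]; last first.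
  by exists g, 1; rewrite rmorph1 oner_eq0 divr1.
split=> [c|x y|x y|x].
- by have [g <-] := evK c; exists g, 1; rewrite rmorph1 oner_eq0 divr1.
- move=> [n [d [d0 ->]]] [n' [d' [d0' ->]]].
  exists (n * d' - n' * d), (d * d'); rewrite rmorphB !rmorphM mulf_neq0 //.
  by split=> //; field; rewrite d0 d0'.
- move=> [n [d [d0 ->]]] [n' [d' [d0' ->]]].
  exists (n * n'), (d * d'); rewrite !rmorphM mulf_neq0 //.
  by split=> //; field; rewrite d0 d0'.
- move=> [n [d [d0 ->]]]; have [n0|n0] := eqVneq (ev n) 0.
    by exists 0, 1; rewrite rmorph0 rmorph1 oner_eq0 n0 !mul0r invr0.
  by exists d, n; rewrite invf_div.
Qed.

(** Multiplying a relation by the denominators of its coefficients. *)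
Lemma acl_poly (G : comNzRingType) (ev : {rmorphism G -> L}) U x :
    (forall c, exists g, ev g = iota c) -> (forall y, U y -> exists g, ev g = y) ->
  acl U x -> exists g : {poly G}, map_poly ev g != 0 /\ root (map_poly ev g) x.
Proof.
move=> evK evU [p [p0 Up px]].
have /choice[n /choice[d ndE]] k := adjoin_frac evK evU (Up k).
pose D := \prod_(k < size p) d k.
pose g := \poly_(k < size p) (n k * \prod_(j < size p | j != k :> nat) d j).
have D0 : ev D != 0.
  by rewrite rmorph_prod; apply/prodf_neq0 => k _; case: (ndE k).
suff gE : map_poly ev g = ev D *: p.
  by exists g; rewrite gE rootZ // scaler_eq0 negb_or D0.
apply/polyP => k; rewrite coef_map coefZ coef_poly.
case: ltnP => [kp|pk]; last by rewrite (nth_default _ pk) mulr0 raddf0.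
have [dk0 ->] := ndE k.
have -> : D = d k * \prod_(j < size p | j != k :> nat) d j.
  by rewrite /D (bigD1 (Ordinal kp)).
rewrite -[LHS]/(ev _) !rmorphM; set q := ev (\prod_(j < _ | _) _).
by field.
Qed.

Lemma poly_acl (G : comNzRingType) (ev : {rmorphism G -> L}) U x (g : {poly G}) :
    (forall a, adjoin iota U (ev a)) -> map_poly ev g != 0 ->
  root (map_poly ev g) x -> acl U x.
Proof.
move=> evU g0 gx; exists (map_poly ev g); split=> // k; rewrite coef_map.
exact: (evU g`_k).
Qed.

Lemma field_horner F (p : {poly L}) x : intermediate_field iota F ->
  (forall k, F p`_k) -> F x -> F p.[x].
Proof.
move=> hF Fp /asboolP Fx; apply/asboolP.
apply: (@rpred_horner _ (fieldp hF)) Fx; apply/polyOverP => k.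
by apply/asboolP.
Qed.

End Closure.

Definition eval_at (A L : comNzRingType) (f : {rmorphism A -> L}) (y : L)
  (p : {poly A}) : L := (map_poly f p).[y].

Section EvalAt.
Variables (A L : comNzRingType) (f : {rmorphism A -> L}) (y : L).

Fact eval_at_is_zmod_morphism : zmod_morphism (eval_at f y).
Proof. by move=> p q; rewrite /eval_at rmorphB hornerD hornerN. Qed.

Fact eval_at_is_monoid_morphism : monoid_morphism (eval_at f y).
Proof.
by rewrite /eval_at; split=> [|p q]; rewrite ?rmorph1 ?hornerC ?rmorphM ?hornerM.
Qed.

HB.instance Definition _ := GRing.isZmodMorphism.Build _ _ (eval_at f y)
  eval_at_is_zmod_morphism.
HB.instance Definition _ := GRing.isMonoidMorphism.Build _ _ (eval_at f y)
  eval_at_is_monoid_morphism.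
End EvalAt.

Lemma eval_atE (A L : comNzRingType) (f : {rmorphism A -> L}) y p :
  eval_at f y p = (map_poly f p).[y].
Proof. by []. Qed.

Lemma eval_atC (A L : comNzRingType) (f : {rmorphism A -> L}) y a :
  eval_at f y a%:P = f a.
Proof. by rewrite eval_atE map_polyC hornerC. Qed.

Lemma eval_atX (A L : comNzRingType) (f : {rmorphism A -> L}) y :
  eval_at f y 'X = y.
Proof. by rewrite eval_atE map_polyX hornerX. Qed.

(** Exchange is the symmetry of a relation [g(x, y) = 0]: read as a polynomial
    in [y] it either makes [y] algebraic over [x], or all its coefficients
    vanish at [x]. *)
Lemma acl_exch (K L : fieldType) (iota : {rmorphism K -> L}) U x y :
  acl iota (addp U [:: y]) x -> ~ acl iota U x -> acl iota (addp U [:: x]) y.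
Proof.
pose F := subfield (adjoin_field iota U).
pose v : {rmorphism F -> L} := subval (hF := adjoin_field iota U).
have vF (a : F) : adjoin iota U (v a) by apply: subfieldP.
have Fv z : adjoin iota U z -> exists a : F, v a = z by apply: subfield_lift.
have [UK _ _ _] := adjoin_field iota U.
move=> Uyx nx; case: (acl_poly (ev := eval_at v y) _ _ Uyx) => [c|z Uz|g [g0 gx]].
- by have [a aE] := Fv _ (UK c); exists a%:P; rewrite /= eval_atC.
- case: Uz => [Uz|/[1!inE]/eqP->].
    by have [a aE] := Fv _ (adjoin_ext Uz); exists a%:P; rewrite /= eval_atC.
  by exists 'X; rewrite /= eval_atX.
have Ev z (p : {poly {poly F}}) :
    map_poly (eval_at v z) p = map_poly (horner_eval z) (map_poly (map_poly v) p).
  by rewrite -map_poly_comp; apply: eq_map_poly.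
have root_y : root (map_poly (eval_at v x) (swapXY g)) y.
  have sw z (u : {poly {poly L}}) :
    map_poly (horner_eval z) u = (swapXY u).[z%:P] by rewrite horner_swapXY.
  move: gx; rewrite /root !Ev -swapXY_map !sw swapXYK.
  by rewrite -[_.[x]]/(_.[y, x]) horner2_swapXY.
have [v0|v0] := eqVneq (map_poly (eval_at v x) (swapXY g)) 0; last first.
  apply: poly_acl v0 root_y => a; rewrite /= eval_atE; apply: (field_horner (adjoin_field _ _)).
    move=> k; rewrite coef_map; apply: (adjoin_min (adjoin_field _ _) _ (vF _)).
    by move=> z Uz; apply: adjoin_ext; left.
  by apply: adjoin_ext; right; rewrite inE.
case: nx; have sg0 : swapXY g != 0.
  by rewrite swapXY_eq0; apply: contraNneq g0 => ->; rewrite rmorph0.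
pose j := (size (swapXY g)).-1.
apply: (@poly_acl _ _ _ _ v _ _ (swapXY g)`_j) => //.
  by rewrite map_poly_eq0 -/(lead_coef _) lead_coef_eq0.
by have := congr1 (fun p : {poly L} => p`_j) v0; rewrite coef_map coef0 => /eqP.
Qed.

Lemma acl_pregeometry (K L : fieldType) (iota : {rmorphism K -> L}) :
  pregeometry (acl iota).
Proof.
split; [exact: acl_ext | exact: acl_trans | exact: acl_exch].
Qed.

(** * Transcendence degree is rank *)

(** The empty base: ranks over it are transcendence degrees over [K]. *)
Definition none {T : Type} : T -> Prop := fun=> False.

Lemma mpoly_morph_eq n (K : comNzRingType) (S : comNzRingType)
    (f g : {rmorphism {mpoly K[n]} -> S}) :
  (forall c, f c%:MP = g c%:MP) -> (forall i, f 'X_i = g 'X_i) -> f =1 g.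
Proof.
move=> fgC fgX p; rewrite (mpolyE p) !rmorph_sum; apply: eq_bigr => m _.
rewrite -mul_mpolyC !rmorphM fgC; congr (_ * _).
rewrite mpolyXE_id !rmorph_prod; apply: eq_bigr => i _.
by rewrite !rmorphXn fgX.
Qed.

(** Polynomials in [n.+1] variables as polynomials in the last one: this links
    relations among [n.+1] elements to algebraicity of the last. *)
Section LastVariable.
Variables (K : comNzRingType) (n : nat).
Local Notation w := (widen_ord (leqnSn n)).

Lemma ord_lastP (i : 'I_n.+1) : (exists j, i = w j) \/ i = ord_max.
Proof.
have [lt_in|le_ni] := ltnP i n; first by left; exists (Ordinal lt_in); apply: val_inj.
by right; apply: val_inj; apply/eqP; rewrite eqn_leq le_ni -ltnS ltn_ord.
Qed.

Lemma muniX_widen i : muni 'X_(w i) = ('X_i)%:P :> {poly {mpoly K[n]}}.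
Proof.
rewrite muniE msuppX big_seq1 mcoeffX eqxx scale1r mnm1E.
rewrite (_ : (_ == _) = false) ?expr0; last first.
  by apply/negbTE; rewrite -val_eqE /= ltn_eqF.
rewrite alg_polyC; congr ('X_[_])%:P; apply/mnmP => j.
by rewrite mnmE !mnm1E -!val_eqE.
Qed.

Lemma muniX_last : muni 'X_ord_max = 'X :> {poly {mpoly K[n]}}.
Proof.
rewrite muniE msuppX big_seq1 mcoeffX eqxx scale1r mnm1E eqxx expr1.
rewrite (_ : [multinom _ | _ < _] = 0%MM) ?mpolyX0 ?scale1r //.
apply/mnmP => j; rewrite mnmE mnm1E mnm0E -val_eqE /=.
by rewrite gtn_eqF.
Qed.

Definition uni_multi : {poly {mpoly K[n]}} -> {mpoly K[n.+1]} :=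
  eval_at (mmap (@mpolyC n.+1 K) (fun i => 'X_(w i))) 'X_ord_max.
HB.instance Definition _ := GRing.RMorphism.on uni_multi.

Lemma muniK : cancel (@muni n K) uni_multi.
Proof.
apply: (@mpoly_morph_eq _ _ _ (uni_multi \o @muni n K) idfun) => [c|i] /=.
  by rewrite muniC /uni_multi eval_atC /= mmapC.
have [[j ->]|->] := ord_lastP i.
  by rewrite muniX_widen /uni_multi eval_atC /= mmapX mmap1U.
by rewrite muniX_last /uni_multi eval_atX.
Qed.

Lemma uni_multiK : cancel uni_multi (@muni n K).
Proof.
have muni_uni_multiC p : muni (uni_multi p%:P) = p%:P.
  rewrite /uni_multi eval_atC; move: p.
  apply: (@mpoly_morph_eq _ _ _
    (@muni n K \o mmap (@mpolyC n.+1 K) (fun i => 'X_(w i))) polyC) => [c|i] /=.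
    by rewrite mmapC muniC.
  by rewrite mmapX mmap1U muniX_widen.
elim/poly_ind => [|p c IHp]; first by rewrite !rmorph0.
by rewrite !rmorphD !rmorphM /= IHp muni_uni_multiC /uni_multi eval_atX muniX_last.
Qed.

Lemma mmap_muni (L : comNzRingType) (iota : {rmorphism K -> L})
    (t : 'I_n.+1 -> L) p :
  mmap iota t p = eval_at (mmap iota (t \o w)) (t ord_max) (muni p).
Proof.
move: p; apply: (@mpoly_morph_eq _ _ _ (mmap iota t)
    (eval_at (mmap iota (t \o w)) (t ord_max) \o @muni n K)) => [c|i] /=.
  by rewrite muniC eval_atC /= !mmapC.
have [[j ->]|->] := ord_lastP i.
  by rewrite muniX_widen eval_atC /= !mmapX !mmap1U.
by rewrite muniX_last eval_atX mmapX mmap1U.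
Qed.
End LastVariable.

Section Trdeg.
Variables (K L : fieldType) (iota : {rmorphism K -> L}).
Local Notation cl := (acl iota).
Local Notation rk := (rks cl).
Let clP := acl_pregeometry iota.

Lemma adjoin_mmap n (t : 'I_n -> L) (U : L -> Prop) (p : {mpoly K[n]}) :
  (forall i, U (t i)) -> adjoin iota U (mmap iota t p).
Proof.
move=> Ut; have hU := adjoin_field iota U.
suff: mmap iota t p \in fieldp hU by move/asboolP.
have mem x : adjoin iota U x -> x \in fieldp hU by move=> ?; apply/asboolP.
apply: rpred_sum => m _; apply: rpredM.
  by apply: mem; case: (hU) => Fc _ _ _; apply: Fc.
by apply: rpred_prod => i _; apply: rpredX; apply: mem; apply: adjoin_ext.
Qed.

Lemma alg_independentS n (t : 'I_n.+1 -> L)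
    (t' := t \o widen_ord (leqnSn n)) :
  alg_independent iota t <->
  alg_independent iota t' /\ ~ cl (fun y => exists i, y = t' i) (t ord_max).
Proof.
split=> [indt|[indt nt] p].
  split=> [p pt|].
    have /indt : mmap iota t (uni_multi p%:P) = 0.
      by rewrite mmap_muni uni_multiK eval_atC.
    move=> /(congr1 (@muni _ _)); rewrite uni_multiK muni0.
    by move=> /polyC_inj.
  case/(acl_poly (ev := mmap iota t')) => [c|_ [i ->]|g [g0 gx]].
  - by exists c%:MP; rewrite /= mmapC.
  - by exists 'X_i; rewrite /= mmapX mmap1U.
  have /indt : mmap iota t (uni_multi g) = 0.
    by rewrite mmap_muni uni_multiK; apply/eqP.
  move=> /(congr1 (@muni _ _)); rewrite uni_multiK muni0 => gE.
  by rewrite gE rmorph0 eqxx in g0.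
rewrite mmap_muni => pt; rewrite -[p]muniK; apply/eqP; rewrite -(rmorph0 (@uni_multi K n)).
apply/eqP; congr (uni_multi _); apply/polyP => k; rewrite coef0.
apply: indt; have [p0|p0] := eqVneq (map_poly (mmap iota t') (muni p)) 0.
  by rewrite -coef_map p0 coef0.
case: nt; apply: poly_acl p0 (_ : root _ _) => [a|]; last exact/eqP.
by apply: adjoin_mmap => i; exists i.
Qed.

(** By induction on the number of elements, with [alg_independentS] for the last
    one. *)
Lemma alg_independent_rks n (t : 'I_n -> L) :
  alg_independent iota t <-> rk none [seq t i | i <- enum 'I_n] = n.
Proof.
elim: n t => [|n IHn] t.
  split=> [_|_ p]; first by apply/eqP; rewrite -leqn0;
    apply: leq_trans (rks_size _ _ _) _; rewrite size_map size_enum_ord.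
  have -> : p = (p@_0%MM)%:MP.
    apply/mpolyP => m; rewrite mcoeffC.
    by rewrite (_ : m = 0%MM) ?eqxx ?mulr1 //; apply/mnmP => -[].
  by rewrite mmapC => /eqP; rewrite fmorph_eq0 => /eqP->; rewrite mpolyC0.
rewrite alg_independentS IHn enum_ordSr map_rcons -cats1 (rks_cat clP) -map_comp /=.
set s := [seq _ | _ <- _].
have sE z : z \in s <-> exists i, z = (t \o widen_ord (leqnSn n)) i.
  split=> [/mapP[i _ ->]|[i ->]]; first by exists i.
  by rewrite map_f // mem_enum.
have := rks_size cl none s; rewrite size_map size_enum_ord => le_s.
have -> : `[< cl (addp none s) (t ord_max) >] =
    `[< cl (fun y => exists i, y = (t \o widen_ord (leqnSn n)) i) (t ord_max) >].
  apply/asbool_equiv_eq; split; apply: (cl_mono clP) => z.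
    by case=> // /sE.
  by move=> /sE; right.
case: asboolP => clt; split=> //=.
- by case.
- by rewrite !addn0 => rs; move: le_s; rewrite rs ltnn.
- by case=> -> _; rewrite addn0 addn1.
- by rewrite addn0 addn1 => -[].
Qed.
End Trdeg.

Definition gens (E : finType) (T : eqType) (f : E -> seq T) (S : {set E}) : seq T :=
  flatten [seq f i | i <- enum S].

Lemma gensP (E : finType) (T : eqType) (f : E -> seq T) (S : {set E}) x :
  reflect (exists2 i, i \in S & x \in f i) (x \in gens f S).
Proof.
apply: (iffP flatten_mapP) => -[i iS xi]; exists i => //.
  by rewrite -mem_enum.
by rewrite mem_enum.
Qed.

Section Trdeg.
Variables (K L : fieldType) (iota : {rmorphism K -> L}).
Local Notation cl := (acl iota).
Local Notation rk := (rks cl).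
Let clP := acl_pregeometry iota.

Lemma has_trdegP F d : has_trdeg iota F d <-> exists s : seq L,
  [/\ forall x, x \in s -> F x, size s = d, rk none s = d &
      forall x, F x -> cl (addp none s) x].
Proof.
split=> [[t [Ft indt Fcl]]|[s [Fs <- rs Fcl]]].
  have tE z : z \in [seq t i | i <- enum 'I_d] <-> exists i, z = t i.
    split=> [/mapP[i _ ->]|[i ->]]; first by exists i.
    by rewrite map_f // mem_enum.
  exists [seq t i | i <- enum 'I_d]; split=> [x /tE[i ->] //|||x /Fcl].
  - by rewrite size_map size_enum_ord.
  - exact/alg_independent_rks.
  - by apply: (cl_mono clP) => z /tE; right.
exists (tnth (in_tuple s)); split=> [i||x /Fcl].
- by apply: Fs; apply: mem_tnth.
- by apply/alg_independent_rks; rewrite map_tnth_enum.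
- apply: (cl_mono clP) => z [//|zs].
  by have /tnthP[i ->] : z \in in_tuple s by []; exists i.
Qed.
End Trdeg.

(** Replacing the subfields by transcendence bases, an algebraic polymatroid is
    given by finite lists of field elements. *)
Lemma algebraicP (K : fieldType) (E : finType) (P : polymatroid E) :
  algebraic K P <-> exists (L : fieldType) (iota : {rmorphism K -> L})
    (f : E -> seq L), forall S, rks (acl iota) none (gens f S) = P S.
Proof.
split=> [[L [iota [F [hF hS]]]]|[L [iota [f fP]]]].
  have clP := acl_pregeometry iota.
  exists L, iota.
  pose U (S : {set E}) x := exists2 i, i \in S & F i x.
  have Usub i (S : {set E}) x : i \in S ->
      adjoin iota (U [set i]) x -> adjoin iota (U S) x.
    move=> iS; apply: adjoin_min; first exact: adjoin_field.
    by move=> z [_ /set1P-> Fz]; apply: adjoin_ext; exists i.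
  have /choice[f fP] i := (has_trdegP _ _ _).1 (hS [set i]).
  exists f => S; have [s [sU ss <- scl]] := (has_trdegP _ _ _).1 (hS S).
  apply/eqP; rewrite eqn_leq; apply/andP; split; apply: (rks_span clP) => z.
    move=> /gensP[i iS zi]; apply: scl; apply: Usub iS _.
    by case: (fP i) => fU _ _ _; apply: fU.
  move=> /sU; apply: adjoin_min; first exact: acl_field.
  move=> y [i iS Fy]; have [_ _ _ fcl] := fP i.
  apply: (@cl_mono _ _ clP (addp none (f i))); last first.
    by apply: fcl; apply: adjoin_ext; exists i; rewrite ?inE.
  by move=> x [//|xi]; right; apply/gensP; exists i.
exists L, iota, (fun i => adjoin iota (fun x => x \in f i)); split.
  by move=> i; apply: adjoin_field.
move=> S; have clP := acl_pregeometry iota.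
have [b [bs bi bsz bcl]] := rks_basis clP none (gens f S).
apply/has_trdegP; exists b; rewrite bi bsz fP; split=> // x.
  by move=> /bs/gensP[i iS xi]; apply: adjoin_ext; exists i => //; apply: adjoin_ext.
apply: adjoin_min; first exact: acl_field.
move=> y [i iS]; apply: adjoin_min; first exact: acl_field.
by move=> z zi; apply: bcl; apply/gensP; exists i.
Qed.

(** * Change of fields *)

Lemma irreducible_factor (F : fieldType) (p : {poly F}) : (1 < size p)%N ->
  exists2 q, irreducible_poly q & q %| p.
Proof.
elim: (size p) {-2}p (leqnn (size p)) => [|n IHn] {}p le_p p1.
  by have := leq_trans p1 le_p.
have [irr_p|red_p] := pselect (irreducible_poly p); first by exists p.
have p0 : p != 0 by rewrite -size_poly_eq0; case: (size p) p1.
have [q [q1 qp nqp]] : exists q : {poly F}, [/\ size q != 1%N, q %| p & ~~ (q %= p)].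
  apply: contra_notP red_p => nq; split=> // q q1 qp.
  by apply: contra_notT nq => nqp; exists q.
have q0 : q != 0 by apply: contraNneq p0 => q0; rewrite q0 dvd0p in qp.
have lt_qp : (size q < size p)%N.
  by rewrite ltn_neqAle dvdp_size_eqp // nqp dvdp_leq.
have [||r irr_r rq] := IHn q.
- by rewrite -ltnS (leq_trans lt_qp).
- by move: q0 q1; rewrite -size_poly_eq0; case: (size q) => [|[]].
by exists r => //; apply: dvdp_trans rq qp.
Qed.

Section ChangeOfFields.
Variables (K L M : fieldType) (iota : {rmorphism K -> L}) (j : {rmorphism L -> M}).
Local Notation img U := (fun w => exists2 u, U u & w = j u).

Lemma adjoin_img U x : adjoin iota U x -> adjoin (j \o iota) (img U) (j x).
Proof.
pose F z := adjoin (j \o iota) (img U) (j z).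
have [FC FB FM FV] := adjoin_field (j \o iota) (img U).
apply: (@adjoin_min _ _ _ _ F) => [|z Uz]; last by apply: adjoin_ext; exists z.
split=> [c|y z|y z|y]; rewrite /F ?rmorphB ?rmorphM ?fmorphV.
- exact: FC.
- exact: FB.
- exact: FM.
- exact: FV.
Qed.

Lemma acl_img U x : acl iota U x -> acl (j \o iota) (img U) (j x).
Proof.
move=> [p [p0 Up px]]; exists (map_poly j p); rewrite map_poly_eq0 p0 fmorph_root.
by split=> // k; rewrite coef_map; apply: adjoin_img.
Qed.

(** A relation with coefficients from [U] over the larger field pulls back, as
    [j] is injective on its coefficients. *)
Lemma acl_img_inv U x : acl (j \o iota) (img U) (j x) -> acl iota U x.
Proof.
pose v : {rmorphism subfield (adjoin_field iota U) -> L} :=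
  subval (hF := adjoin_field iota U).
have [UK _ _ _] := adjoin_field iota U.
case/(acl_poly (ev := j \o v)) => [c|_ [u Uu ->]|g [g0 gx]].
- by have [a aE] := subfield_lift (adjoin_field iota U) (UK c);
    exists a; rewrite /= -aE.
- by have [a aE] := subfield_lift (adjoin_field iota U) (adjoin_ext Uu);
    exists a; rewrite /= -aE.
apply: (@poly_acl _ _ _ _ v _ _ g) => [a||]; first exact: subfieldP.
  by apply: contraNneq g0; rewrite map_poly_comp /= => ->; rewrite rmorph0.
by rewrite -(fmorph_root j) -map_poly_comp.
Qed.

End ChangeOfFields.

(** A map of indexed families that keeps dependences lowers the greedy rank
    entry by entry. *)
Lemma rks_le_map (I : eqType) (T T' : eqType)
    (cl : (T -> Prop) -> T -> Prop) (cl' : (T' -> Prop) -> T' -> Prop)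
    (U : T -> Prop) (U' : T' -> Prop) (f : I -> T) (f' : I -> T') w :
  pregeometry cl -> pregeometry cl' ->
  (forall w i, cl (addp U [seq f k | k <- w]) (f i) ->
     cl' (addp U' [seq f' k | k <- w]) (f' i)) ->
  (rks cl' U' [seq f' k | k <- w] <= rks cl U [seq f k | k <- w])%N.
Proof.
move=> clP clP'; elim: w U U' => //= i w IHw U U' le_cl; apply: leq_add.
  case: asboolP => //= nUi; case: asboolP => // Ui; case: nUi.
  have /(cl_mono clP') : cl' (addp U' [seq f' k | k <- [::]]) (f' i).
    by apply: le_cl; apply: (cl_mono clP) Ui => z; left.
  by apply=> z [].
apply: IHw => v k.
have cE (T0 : eqType) (c : (T0 -> Prop) -> T0 -> Prop) V (g : I -> T0) : pregeometry c ->
    c (addp (addp V [:: g i]) [seq g k | k <- v]) (g k) <->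
    c (addp V [seq g k | k <- i :: v]) (g k).
  by move=> cP; split; apply: (cl_mono cP) => z /(addp_cat V [:: g i]).
by rewrite !cE //; apply: le_cl.
Qed.

Lemma acl_sub (K K' L : fieldType) (iota : {rmorphism K -> L})
    (iota' : {rmorphism K' -> L}) (U V : L -> Prop) x :
  (forall c, acl iota' V (iota c)) -> (forall u, U u -> acl iota' V u) ->
  acl iota U x -> acl iota' V x.
Proof.
move=> sub_c sub_u Ux; apply: (algebraic_over_trans (adjoin_field iota' V)).
apply: algebraic_over_mono Ux => z; apply: adjoin_min sub_u.
by case: (acl_field iota' V).
Qed.

Lemma acl_const (K L : fieldType) (iota : {rmorphism K -> L}) U c :
  acl iota U (iota c).
Proof. by case: (acl_field iota U). Qed.

Lemma rks_acl_le (K K' L : fieldType) (iota : {rmorphism K -> L})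
    (iota' : {rmorphism K' -> L}) (U V : L -> Prop) s :
  (forall c, acl iota' V (iota c)) -> (forall u, U u -> acl iota' V u) ->
  (rks (acl iota') V s <= rks (acl iota) U s)%N.
Proof.
move=> sub_c sub_u; rewrite -[s]map_id.
have mo W z : acl iota' V z -> acl iota' (addp V W) z.
  by apply: (cl_mono (acl_pregeometry _)) => ?; left.
apply: rks_le_map => [||w i]; [exact: acl_pregeometry | exact: acl_pregeometry |].
apply: acl_sub => [c|u [/sub_u/mo //|uw]]; first exact: mo.
by apply: (cl_in (acl_pregeometry _)).
Qed.

(** * Specialization *)

Lemma adjoin_root (F : fieldType) (p : {poly F}) : (1 < size p)%N ->
  exists (F' : fieldType) (j : {rmorphism F -> F'}) (z : F'),
    root (map_poly j p) z /\ forall y, acl j none y.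
Proof.
move=> /irreducible_factor[q irr_q qp].
have [F' _ [z qz _]] := irredp_FAdjoin irr_q.
exists F', (in_alg F' : {rmorphism F -> F'}), z; split=> [|y].
  by move: qz; rewrite -!dvdp_XsubCl => /dvdp_trans; apply; rewrite dvdp_map.
have /polyOver1P[r rE] := minPolyOver 1%AS y.
apply: (@poly_acl _ _ _ _ (in_alg F' : {rmorphism F -> F'}) none y r).
- by move=> a; case: (adjoin_field (in_alg F' : {rmorphism F -> F'}) none).
- by rewrite -rE monic_neq0 // monic_minPoly.
- by rewrite -rE root_minPoly.
Qed.

(** The kernels are compared instead of asking for a map on the image of [ev]:
    the image need not be available as a ring. *)
Definition specializes (A L M : nzRingType) (ev : A -> L) (ev' : A -> M) :=
  forall a, ev a = 0 -> ev' a = 0.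

Section Step.
Variables (K L : fieldType) (A : idomainType).
Variables (iA : {rmorphism K -> A}) (ev : {rmorphism A -> L}).
Local Notation cl := (acl (ev \o iA)).
Local Notation rng := (fun x : L => exists a, x = ev a).

Lemma specializes_map (M : fieldType) (ev' : {rmorphism A -> M}) (g h : {poly A}) :
  specializes ev ev' -> map_poly ev g = map_poly ev h ->
  map_poly ev' g = map_poly ev' h.
Proof.
move=> sp gh; apply/eqP; rewrite -subr_eq0 -rmorphB; apply/eqP/polyP => k.
rewrite coef_map coef0; apply: sp; rewrite -coef_map rmorphB /= gh subrr.
by rewrite coef0.
Qed.

Lemma acl_relation x : cl rng x ->
  exists g : {poly A}, map_poly ev g != 0 /\ root (map_poly ev g) x.
Proof.
by apply: acl_poly => [c|_ [a ->]]; [exists (iA c) | exists a].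
Qed.

Lemma relation_acl x (g : {poly A}) :
  map_poly ev g != 0 -> root (map_poly ev g) x -> cl rng x.
Proof. by apply: poly_acl => a; apply: adjoin_ext; exists a. Qed.

(** As [ev] need not be injective, the degree of a relation is only meaningful
    once the leading coefficients in its kernel are dropped. *)
Lemma trim (g : {poly A}) : map_poly ev g != 0 -> exists g' : {poly A},
  [/\ ev (lead_coef g') != 0, map_poly ev g' = map_poly ev g &
      (size g' <= size g)%N].
Proof.
move=> g0; pose n := size (map_poly ev g); pose g' := \poly_(i < n) g`_i.
have g'E : map_poly ev g' = map_poly ev g.
  apply/polyP => k; rewrite !coef_map coef_poly /=; case: ltnP => // nk.
  by rewrite rmorph0 -coef_map nth_default.
have le_n : (n <= size g)%N by apply: size_poly.
exists g'; split=> //; last exact: leq_trans (size_poly _ _) le_n.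
have n0 : (0 < n)%N by rewrite size_poly_gt0.
have : g'`_n.-1 != 0 /\ ev g'`_n.-1 != 0.
  have : ev g'`_n.-1 != 0 by rewrite -coef_map g'E -/(lead_coef _) lead_coef_eq0.
  by move=> e0; split=> //; apply: contraNneq e0 => ->; rewrite rmorph0.
case=> c0 e0; suff -> : lead_coef g' = g'`_n.-1 by [].
congr (_`_ _.-1); apply/eqP; rewrite eqn_leq size_poly /=.
by rewrite -[leqLHS](prednK n0) ltnNge; apply: contraNN c0 => /(nth_default 0)->.
Qed.

(** A relation of least degree. The remainder of any other relation by it has
    smaller degree and vanishes at [y], hence is zero under [ev]. *)
Lemma minimal_relation y : cl rng y -> exists p : {poly A},
  [/\ ev (lead_coef p) != 0, (1 < size p)%N, root (map_poly ev p) y,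
      forall r : {poly A}, (size r < size p)%N -> root (map_poly ev r) y ->
        map_poly ev r = 0 &
      forall g, root (map_poly ev g) y -> exists k q,
        map_poly ev (lead_coef p ^+ k *: g) = map_poly ev (q * p)].
Proof.
move=> /acl_relation[g0 [/trim[g1 [l1 <- _]] g1y]].
pose P n := `[< exists p : {poly A},
  [/\ size p = n, ev (lead_coef p) != 0 & root (map_poly ev p) y] >].
have exP : exists n, P n by exists (size g1); apply/asboolP; exists g1.
case: (ex_minnP exP) => n /asboolP[p [sz lp py]] min_n.
have p0 : p != 0 by apply: contraNneq lp => ->; rewrite lead_coef0 rmorph0.
have small (r : {poly A}) : (size r < size p)%N -> root (map_poly ev r) y -> map_poly ev r = 0.
  move=> lt_rp ry; apply: contraTeq lt_rp => /trim[r' [lr' r'E le_r']].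
  rewrite -leqNgt (leq_trans _ le_r') // sz; apply: min_n; apply/asboolP.
  by exists r'; rewrite r'E.
exists p; split=> // [|g gy].
  rewrite ltnNge; apply: contraL py => /size1_polyC pE.
  move: lp; rewrite pE lead_coefC map_polyC /root hornerC.
  exact: id.
exists (scalp g p), (g %/ p).
have := Pdiv.Idomain.divp_eq g p; set r := g %% p => ->.
rewrite rmorphD /= (small r) ?addr0 ?ltn_modp //.
have : map_poly ev (lead_coef p ^+ scalp g p *: g) = map_poly ev (g %/ p * p + r).
  by rewrite Pdiv.Idomain.divp_eq.
rewrite map_polyZ rmorphD rmorphM /= => /(congr1 (horner^~ y)).
rewrite hornerZ hornerD hornerM (rootP gy) (rootP py) !mulr0 add0r => r0.
by apply/eqP.
Qed.

(** Extension of a specialization to an algebraic element [y]. The new value is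
    a root of the minimal relation [p] of [y], whose leading coefficient must
    survive. To keep the value of [h] nonzero, its own minimal relation [q] is
    used: as [q] of [h] specializes to zero, a zero of [h] would be a zero of the
    constant coefficient of [q]. *)
Lemma specialize_algebraic y (h : {poly A}) : cl rng y -> eval_at ev y h != 0 ->
  exists2 a, ev a != 0 & forall (M : fieldType) (ev' : {rmorphism A -> M}),
    specializes ev ev' -> ev' a != 0 ->
    exists (M' : fieldType) (j : {rmorphism M -> M'}) (y' : M'),
    [/\ forall z, acl j none z,
        specializes (eval_at ev y) (eval_at (j \o ev') y') &
        eval_at (j \o ev') y' h != 0].
Proof.
move=> cly h0; have [p [lp sp py _ divp]] := minimal_relation cly.
have clh : cl rng (eval_at ev y h).
  apply: (field_horner (acl_field _ _)) cly => k; rewrite coef_map.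
  by apply: acl_ext; exists h`_k.
have [q [lq sq qh minq _]] := minimal_relation clh.
(* Otherwise [q] divided by the variable would be a smaller relation. *)
have q0 : ev q`_0 != 0.
  apply: contraNneq lq => q0; have qE := poly_take_drop 1 q.
  have tE : map_poly ev (take_poly 1 q) = 0.
    apply/polyP => k; rewrite coef_map coef_take_poly coef0.
    by case: k => [|k] //=; rewrite rmorph0.
  have mE : map_poly ev q = map_poly ev (drop_poly 1 q) * 'X.
    by rewrite -{1}qE rmorphD rmorphM /= tE add0r expr1 map_polyX.
  have dE : map_poly ev (drop_poly 1 q) = 0.
    apply: minq; first by rewrite size_drop_poly subn1 prednK // (ltn_trans _ sq).
    move: qh; rewrite /root mE.
    by rewrite hornerM hornerX mulf_eq0 (negbTE h0) orbF.
  by rewrite -coef_map mE dE mul0r coef0.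
exists (lead_coef p * q`_0); first by rewrite rmorphM mulf_neq0.
move=> M ev' sp'; rewrite rmorphM mulf_eq0 negb_or => /andP[lp' q0'].
have [|M' [j [y' [py' algM']]]] := @adjoin_root _ (map_poly ev' p).
  by rewrite size_map_poly_id0.
have spec : specializes (eval_at ev y) (eval_at (j \o ev') y').
  move=> g /eqP gy; have [k [r rE]] := divp g gy.
  have := specializes_map sp' rE; rewrite map_polyZ rmorphM /=.
  move=> /(congr1 (fun g => (map_poly j g).[y'])) /eqP.
  rewrite map_polyZ rmorphM hornerZ hornerM (rootP py') mulr0 mulf_eq0.
  rewrite rmorphXn fmorph_eq0 /= expf_eq0 (negbTE lp') andbF /= => /eqP.
  by rewrite /eval_at map_poly_comp.
exists M', j, y'; split=> //.
have /spec : eval_at ev y (q \Po h) = 0.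
  by rewrite /eval_at map_comp_poly horner_comp; apply/eqP.
rewrite /eval_at map_comp_poly horner_comp; apply: contra_eqN => /eqP ->.
by rewrite horner_coef0 coef_map /= fmorph_eq0.
Qed.

(** A transcendental element may be sent to any element, so here to one that is
    algebraic. A root of [1 + T h(T)] is not a root of [h], even over a finite
    field. *)
Lemma specialize_closed y (h : {poly A}) : eval_at ev y h != 0 ->
  exists2 a, ev a != 0 & forall (M : fieldType) (ev' : {rmorphism A -> M}),
    specializes ev ev' -> ev' a != 0 ->
    exists (M' : fieldType) (j : {rmorphism M -> M'}) (y' : M'),
    [/\ forall z, acl j none z,
        specializes (eval_at ev y) (eval_at (j \o ev') y') &
        eval_at (j \o ev') y' h != 0].
Proof.
have [cly|ncl] := pselect (cl rng y); first exact: specialize_algebraic cly.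
move=> hy; have h0 : map_poly ev h != 0.
  by apply: contraNneq hy; rewrite /eval_at => ->; rewrite horner0.
exists (h`_(size (map_poly ev h)).-1).
  by rewrite -coef_map -/(lead_coef _) lead_coef_eq0.
move=> M ev' sp' a0; have h0' : map_poly ev' h != 0.
  by apply: contraNneq a0 => h0'; rewrite -coef_map h0' coef0.
pose r := 'X * map_poly ev' h + 1.
have [|M' [j [y' [ry' algM']]]] := @adjoin_root _ r.
  rewrite size_addl ?size_poly1 mulrC size_mulX //.
    by rewrite ltnS size_poly_gt0.
  by rewrite ltnS size_poly_gt0.
exists M', j, y'; split=> // [g gy|]; rewrite /eval_at.
  have [g0|g0] := eqVneq (map_poly ev g) 0; last first.
    by case: ncl; apply: relation_acl g0 _; apply/eqP.
  have /(specializes_map sp') : map_poly ev g = map_poly ev 0 by rewrite g0 rmorph0.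
  by rewrite map_poly_comp => ->; rewrite !rmorph0 horner0.
apply: contraTneq ry' => hy'; rewrite /root rmorphD rmorphM rmorph1 /= map_polyX.
by rewrite -map_poly_comp hornerD hornerM hy' mulr0 add0r hornerC oner_eq0.
Qed.

(** Here [y] becomes an indeterminate over [M]. *)
Lemma specialize_generic y (h : {poly A}) : ~ cl rng y -> eval_at ev y h != 0 ->
  exists2 a, ev a != 0 & forall (M : fieldType) (ev' : {rmorphism A -> M}),
    specializes ev ev' -> ev' a != 0 ->
    exists (M' : fieldType) (j : {rmorphism M -> M'}) (y' : M'),
    [/\ ~ acl j none y',
        specializes (eval_at ev y) (eval_at (j \o ev') y') &
        eval_at (j \o ev') y' h != 0].
Proof.
move=> ncl hy; have h0 : map_poly ev h != 0.
  by apply: contraNneq hy; rewrite /eval_at => ->; rewrite horner0.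
exists (h`_(size (map_poly ev h)).-1).
  by rewrite -coef_map -/(lead_coef _) lead_coef_eq0.
move=> M ev' sp' a0; have h0' : map_poly ev' h != 0.
  by apply: contraNneq a0 => h0'; rewrite -coef_map h0' coef0.
pose j : {rmorphism M -> {fraction {poly M}}} := @tofrac _ \o polyC.
have jX (g : {poly M}) : (map_poly j g).[tofrac 'X] = tofrac g.
  by rewrite map_poly_comp horner_map /= -/(comp_poly _ _) comp_polyXr.
exists {fraction {poly M}}, j, (tofrac 'X); split=> [|g gy|]; rewrite /eval_at.
- case/(acl_poly (ev := j)) => [c|_ []|g [g0 /eqP]]; first by exists c.
  rewrite jX => /eqP; rewrite tofrac_eq0 => /eqP g0'.
  by rewrite g0' rmorph0 eqxx in g0.
- have [g0|g0] := eqVneq (map_poly ev g) 0; last first.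
    by case: ncl; apply: relation_acl g0 _; apply/eqP.
  have /(specializes_map sp') : map_poly ev g = map_poly ev 0 by rewrite g0 rmorph0.
  by rewrite map_poly_comp => ->; rewrite !rmorph0 horner0.
- by rewrite map_poly_comp jX tofrac_eq0.
Qed.

End Step.

(** Specializations of [A] extend to [B], as soon as they keep nonzero one
    element of [A] that depends on the element [h] of [B] to be kept nonzero.
    This form composes: lists are adjoined one element at a time, and the
    conditions are passed backwards to the first ring. The target field grows
    along [j], and [good] records the control on how. *)
Definition lifts (L : fieldType) (A B : idomainType) (i : {rmorphism A -> B})
    (ev : {rmorphism A -> L}) (evB : {rmorphism B -> L})
    (good : forall M M' : fieldType, {rmorphism M -> M'} -> (B -> M') -> Prop) :=
  forall h, evB h != 0 -> exists2 a, ev a != 0 &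
    forall (M : fieldType) (ev' : {rmorphism A -> M}),
      specializes ev ev' -> ev' a != 0 ->
    exists (M' : fieldType) (j : {rmorphism M -> M'}) (evB' : {rmorphism B -> M'}),
    [/\ forall x, evB' (i x) = j (ev' x), specializes evB evB', evB' h != 0 &
        good M M' j evB'].

Section Chains.
Variables (K L : fieldType).

Lemma lift_closed (s : seq L) (A : idomainType) (iA : {rmorphism K -> A})
    (ev : {rmorphism A -> L}) :
  exists (B : idomainType) (i : {rmorphism A -> B}) (evB : {rmorphism B -> L})
    (bs : seq B),
  [/\ forall a, evB (i a) = ev a, [seq evB b | b <- bs] = s,
      forall b, acl (ev \o iA) (addp (fun x => exists a, x = ev a) s) (evB b) &
      lifts i ev evB (fun M M' j _ => forall z, acl j none z)].
Proof.
elim: s A iA ev => [|y s IHs] A iA ev.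
  exists A, (idfun : {rmorphism A -> A}), ev, [::]; split=> // [b|h h0].
    by apply: acl_ext; left; exists b.
  exists h => // M ev' sp' h0'.
  exists M, (idfun : {rmorphism M -> M}), ev'; split=> // z.
  exact: (acl_const (idfun : {rmorphism M -> M})).
have [B [i [evB [bs [evBE bsE genB lB]]]]] :=
  IHs {poly A} (polyC \o iA) (eval_at ev y).
exists B, (i \o polyC), evB, (i 'X :: bs); split=> [a||b|h /lB[h1 h10 lB1]].
- by rewrite /= evBE /= eval_atC.
- by rewrite /= bsE evBE /= eval_atX.
- apply: acl_sub (genB b) => [c|u [[a ->]|us]].
  + rewrite /= eval_atC; exact: (acl_const (ev \o iA)).
  + apply: (field_horner (acl_field _ _)) => [k|].
      by rewrite coef_map; apply: acl_ext; left; exists a`_k.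
    by apply: acl_ext; right; apply: mem_head.
  + by apply: acl_ext; right; rewrite inE us orbT.
have [a a0 lA] := specialize_closed iA h10; exists a => // M ev' sp' a0'.
have [M1 [j1 [y1 [alg1 sp1 h1']]]] := lA M ev' sp' a0'.
have [M' [j [evB' [E' spB h' algj]]]] := lB1 M1 (eval_at (j1 \o ev') y1) sp1 h1'.
exists M', (j \o j1), evB'; split=> // [x|z].
  by rewrite /= E' /= eval_atC.
apply: acl_sub (algj z) => // c.
by have := acl_img j (alg1 c); apply: (cl_mono (acl_pregeometry _)) => u [].
Qed.

Lemma lift_generic (s : seq L) (A : idomainType) (iA : {rmorphism K -> A})
    (ev : {rmorphism A -> L}) :
  rks (acl (ev \o iA)) (fun x => exists a, x = ev a) s = size s ->
  exists (B : idomainType) (i : {rmorphism A -> B}) (evB : {rmorphism B -> L})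
    (bs : seq B),
  [/\ forall a, evB (i a) = ev a, [seq evB b | b <- bs] = s &
      lifts i ev evB
        (fun M M' j evB' => (size s <= rks (acl j) none [seq evB' b | b <- bs])%N)].
Proof.
elim: s A iA ev => [|y s IHs] A iA ev rs.
  exists A, (idfun : {rmorphism A -> A}), ev, [::]; split=> // h h0.
  exists h => // M ev' sp' h0'.
  by exists M, (idfun : {rmorphism M -> M}), ev'.
have clP := acl_pregeometry (ev \o iA).
have [ncl rs'] : ~ acl (ev \o iA) (fun x => exists a, x = ev a) y /\
    rks (acl (ev \o iA)) (addp (fun x => exists a, x = ev a) [:: y]) s = size s.
  move: rs => /=; have := rks_size (acl (ev \o iA))
    (addp (fun x => exists a, x = ev a) [:: y]) s.
  case: asboolP => cy le /=; last by rewrite add1n => -[].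
  by rewrite add0n => rE; move: le; rewrite rE ltnn.
have [|B [i [evB [bs [evBE bsE lB]]]]] :=
  IHs {poly A} (polyC \o iA) (eval_at ev y).
  apply/eqP; rewrite eqn_leq rks_size -{1}rs'.
  apply: rks_acl_le => [c|_ [a ->]].
    rewrite /= eval_atC; exact: (acl_const (ev \o iA)).
  apply: (field_horner (acl_field _ _)) => [k|].
    by rewrite coef_map; apply: acl_ext; left; exists a`_k.
  by apply: cl_in => //; rewrite inE.
exists B, (i \o polyC), evB, (i 'X :: bs); split=> [a||h /lB[h1 h10 lB1]].
- by rewrite /= evBE /= eval_atC.
- by rewrite /= bsE evBE /= eval_atX.
have [a a0 lA] := specialize_generic ncl h10; exists a => // M ev' sp' a0'.
have [M1 [j1 [y1 [trans1 sp1 h1']]]] := lA M ev' sp' a0'.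
have [M' [j [evB' [E' spB h' rj]]]] := lB1 M1 (eval_at (j1 \o ev') y1) sp1 h1'.
exists M', (j \o j1), evB'; split=> // [x|].
  by rewrite /= E' /= eval_atC.
rewrite /= E' /= eval_atX -add1n; apply: leq_add.
  rewrite lt0b; apply/asboolPn => yj; apply: trans1; apply: (acl_img_inv (j := j)).
  by apply: (cl_mono (acl_pregeometry _)) yj => u [].
apply: leq_trans rj _; apply: rks_acl_le => [c|u [//|]].
  exact: acl_const.
by rewrite inE => /eqP ->; apply: acl_const.
Qed.
End Chains.

(** The three stages of the construction: [t] becomes algebraic, [b] becomes
    independent, and [x] follows. The conditions collected on the way end as a
    single nonzero element of the field [K], which no homomorphism kills. *)
Lemma specialization (K L : fieldType) (iota : {rmorphism K -> L}) (t b x : seq L) :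
  rks (acl iota) (addp none t) b = size b ->
  exists (B : idomainType) (i : {rmorphism K -> B}) (ev : {rmorphism B -> L})
    (tB bB xB : seq B),
  [/\ forall c, ev (i c) = iota c, [seq ev z | z <- tB] = t,
      [seq ev z | z <- bB] = b, [seq ev z | z <- xB] = x &
      forall h, ev h != 0 -> forall (M : fieldType) (kappa : {rmorphism K -> M}),
      exists (M' : fieldType) (j : {rmorphism M -> M'}) (ev' : {rmorphism B -> M'}),
      [/\ forall c, ev' (i c) = j (kappa c), specializes ev ev', ev' h != 0,
          forall z, z \in tB -> acl j none (ev' z) &
          (size b <= rks (acl j) none [seq ev' z | z <- bB])%N]].
Proof.
move=> rb.
have [B1 [i1 [ev1 [t1 [E1 t1E gen1 lift1]]]]] :=
  lift_closed t (idfun : {rmorphism K -> K}) iota.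
have [|B2 [i2 [ev2 [b2 [E2 b2E lift2]]]]] := @lift_generic K L b B1 i1 ev1.
  apply/eqP; rewrite eqn_leq rks_size -{1}rb.
  apply: rks_acl_le => [c|_ [a ->]].
    rewrite /= E1; exact: acl_const.
  apply: acl_sub (gen1 a) => [c|u [[c ->]|us]].
  - exact: acl_const.
  - exact: acl_const.
  - by apply: acl_ext; right.
have [B3 [i3 [ev3 [x3 [E3 x3E _ lift3]]]]] := lift_closed x (i2 \o i1) ev2.
exists B3, (i3 \o (i2 \o i1)), ev3, [seq i3 (i2 z) | z <- t1], [seq i3 z | z <- b2], x3.
split=> [c||||h /lift3[h2 h20 {}lift3] M kappa] //.
- by rewrite /= E3 E2 E1.
- by rewrite -map_comp -[RHS]t1E; apply: eq_map => z /=; rewrite E3 E2.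
- by rewrite -map_comp -[RHS]b2E; apply: eq_map => z /=; rewrite E3.
have [h1 h10 {}lift2] := lift2 _ h20.
have [a a0 {}lift1] := lift1 _ h10.
have spK : specializes iota kappa.
  by move=> c /eqP; rewrite fmorph_eq0 => /eqP->; rewrite rmorph0.
have [|M1 [j1 [ev1' [E1' sp1 h1' alg1]]]] := lift1 M kappa spK.
  by rewrite fmorph_eq0 -(fmorph_eq0 iota).
have [M2 [j2 [ev2' [E2' sp2 h2' gen2]]]] := lift2 _ _ sp1 h1'.
have [M3 [j3 [ev3' [E3' sp3 h3' _]]]] := lift3 _ _ sp2 h2'.
exists M3, (j3 \o (j2 \o j1)), ev3'; split=> // [c|_ /mapP[z _ ->]|].
- by rewrite /= E3' E2' E1'.
- rewrite E3' E2'.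
  have := acl_img j3 (acl_img j2 (alg1 (ev1' z))).
  by apply: (cl_mono (acl_pregeometry _)) => u [v [w nw _] _]; exact: nw.
- apply: leq_trans gen2 _; rewrite -map_comp.
  rewrite (eq_map (g := j3 \o ev2')); last by move=> z /=; rewrite E3'.
  rewrite map_comp -[X in rks (acl j2) _ X]map_id.
  apply: rks_le_map => [||w z]; [exact: acl_pregeometry | exact: acl_pregeometry |].
  move=> clz; apply: (acl_img_inv (j := j3)); apply: acl_sub clz => [c|u [//|]].
    exact: (acl_const (j3 \o j2) _ (j1 c)).
  by move=> /mapP[v vw ->]; apply: acl_ext; exists v => //; right; rewrite map_id.
Qed.

(** Take for [h] a nonzero coefficient of a relation of [ev x]: as long as it
    survives, the relation remains nontrivial under [ev']. *)
Lemma preserve_acl (K L : fieldType) (B : idomainType) (iB : {rmorphism K -> B})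
    (ev : {rmorphism B -> L}) (w : seq B) (x : B) :
  acl (ev \o iB) (addp none [seq ev z | z <- w]) (ev x) ->
  exists2 h, ev h != 0 & forall (M : fieldType) (ev' : {rmorphism B -> M}),
    specializes ev ev' -> ev' h != 0 ->
    acl (ev' \o iB) (addp none [seq ev' z | z <- w]) (ev' x).
Proof.
pose phi := mmap iB (tnth (in_tuple w)).
case/(acl_poly (ev := ev \o phi)) => [c|_ [//|/mapP[z zw ->]]|g [g0 gx]].
- by exists c%:MP; rewrite /= mmapC.
- have /tnthP[i ->] : z \in in_tuple w by [].
  by exists 'X_i; rewrite /= mmapX mmap1U.
pose k := (size (map_poly (ev \o phi) g)).-1.
have hk : ev (phi g`_k) != 0.
  by move: g0; rewrite -lead_coef_eq0 lead_coefE coef_map.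
exists (phi g`_k) => // M ev' sp' hk'.
apply: (@poly_acl _ _ _ _ (ev' \o phi) _ _ g) => [a||].
- have aE : ev' (phi a) = mmap (ev' \o iB) (ev' \o tnth (in_tuple w)) a.
    move: a; apply: (@mpoly_morph_eq _ _ _ (ev' \o phi)) => [c|i] /=.
      by rewrite !mmapC.
    by rewrite !mmapX !mmap1U.
  rewrite /= aE; apply: adjoin_mmap => i; right; apply: map_f; exact: mem_tnth.
- by apply: contraNneq hk' => g0'; rewrite -[ev' _](coef_map (ev' \o phi)) g0' coef0.
- have /sp' : ev (map_poly phi g).[x] = 0.
    by rewrite -horner_map -map_poly_comp; apply/eqP.
  by rewrite -horner_map -map_poly_comp => /eqP.
Qed.

(** The matroid of [x] over [K(t)] is realized over any extension [M] of [K].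
    Keeping nonzero the product of the elements that [preserve_acl] gives for
    all pairs of a subset and an index, no rank goes up; the total rank does not
    go down because a basis of [x] stays independent, so by [rks_cat] no rank
    of a part goes down either. With [M] equal to [K] this removes [t] from the
    ground field; with [t] empty it makes [x] free from [M]. *)
Lemma transfer (K L M : fieldType) (iota : {rmorphism K -> L})
    (kappa : {rmorphism K -> M}) (I : finType) (t : seq L) (x : I -> L) :
  exists (M' : fieldType) (j : {rmorphism M -> M'}) (x' : I -> M'),
    (forall w, rks (acl j) none [seq x' i | i <- w] =
               rks (acl iota) (addp none t) [seq x i | i <- w]) /\
    (t = [::] -> forall w, (rks (acl (j \o kappa)) none [seq x' i | i <- w] <=
               rks (acl iota) none [seq x i | i <- w])%N).
Proof.
have clP := acl_pregeometry iota.
pose xs := [seq x i | i <- enum I].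
have [b [bx rb szb clb]] := rks_basis clP (addp none t) xs.
have [B [iB [ev [tB [bB [xB [Ei tE bE xE spec]]]]]]] := specialization xs rb.
have xi i : exists z, ev z = x i.
  have : x i \in [seq ev z | z <- xB] by rewrite xE map_f // mem_enum.
  by case/mapP => z _ ->; exists z.
have [y yE] := choice xi.
pose dep (S : {set I}) i h := ev h != 0 /\ forall (N : fieldType) (ev' : {rmorphism B -> N}),
  specializes ev ev' -> ev' h != 0 ->
  acl iota (addp none (t ++ [seq x k | k <- enum S])) (x i) ->
  acl (ev' \o iB) (addp none ([seq ev' z | z <- tB] ++ [seq ev' (y k) | k <- enum S]))
    (ev' (y i)).
have ex_dep (p : {set I} * I) : exists h, dep p.1 p.2 h.
  case: p => S i /=.
  have [cli|ncli] := pselect (acl iota (addp none (t ++ [seq x k | k <- enum S])) (x i));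
    last by exists 1; split=> //; rewrite rmorph1 oner_eq0.
  have [|h h0 hP] := @preserve_acl K L B iB ev (tB ++ [seq y k | k <- enum S]) (y i).
    rewrite yE map_cat tE -map_comp (eq_map (g := x)) //.
    by apply: acl_sub cli => [c|u]; [rewrite -Ei; apply: acl_const | apply: acl_ext].
  exists h; split=> // N ev' sp' h0' _.
  by have := hP N ev' sp' h0'; rewrite map_cat -map_comp.
have [h hP] := choice ex_dep.
have [|M' [j [ev' [E' sp' h0' t' b']]]] := spec (\prod_p h p) _ M kappa.
  by rewrite rmorph_prod; apply/prodf_neq0 => p _; case: (hP p).
have hp0 p : ev' (h p) != 0.
  by move: h0'; rewrite rmorph_prod => /prodf_neq0; apply.
exists M', j, (ev' \o y).
have cl'P := acl_pregeometry (j \o kappa).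
have cljP := acl_pregeometry j.
have keep w i : acl iota (addp (addp none t) [seq x k | k <- w]) (x i) ->
    acl (j \o kappa) (addp (addp none [seq ev' z | z <- tB]) [seq ev' (y k) | k <- w])
      (ev' (y i)).
  move=> cli; have memw k : (k \in enum [set k in w]) = (k \in w).
    by rewrite mem_enum inE.
  have [_ /(_ M' ev' sp' (hp0 _))] := hP ([set k in w], i).
  case=> [|p [p0 pU pi]].
    apply: (cl_mono clP) cli => z /addp_cat[//|]; right.
    move: b0; rewrite !mem_cat => /orP[->//|/mapP[k kw ->]].
    by rewrite map_f ?memw // orbT.
  have : acl (ev' \o iB) (addp none ([seq ev' z | z <- tB] ++
     [seq ev' (y k) | k <- enum [set k in w]])) (ev' (y i)) by exists p.
  apply: acl_sub => [c|u [//|uw]].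
    rewrite /= E'; exact: (acl_const (j \o kappa)).
  apply: acl_ext; apply/addp_cat; right.
  move: uw; rewrite !mem_cat => /orP[->//|/mapP[k kw ->]].
  rewrite memw in kw; apply/orP; right.
  exact: (map_f (fun k => ev' (y k))).
have up v w : (rks (acl j) (addp none [seq ev' (y k) | k <- v]) [seq (ev' \o y) k | k <- w] <=
    rks (acl iota) (addp (addp none t) [seq x k | k <- v]) [seq x k | k <- w])%N.
  apply: rks_le_map => // u i cli.
  have /keep : acl iota (addp (addp none t) [seq x k | k <- v ++ u]) (x i).
    by apply: (cl_mono clP) cli => z /addp_cat; rewrite map_cat.
  apply: acl_sub => [c|z [[//|/mapP[s st ->]]|]].
  - exact: (acl_const j).
  - apply: (cl_mono cljP) (t' s st) => ? [].
  - by rewrite map_cat => zvu; apply: acl_ext; apply/addp_cat; right.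
split=> [w|t0 w]; last first.
  have tB0 : tB = [::] by apply: size0nil; rewrite -(size_map ev) tE t0.
  apply: rks_le_map => // u i cli.
  have /keep : acl iota (addp (addp none t) [seq x k | k <- u]) (x i).
    by apply: (cl_mono clP) cli => z [//|]; right.
  by apply: (cl_mono cl'P) => z [[]|]; rewrite ?tB0 //; right.
have nil_ext (N : eqType) cl (U : N -> Prop) s : pregeometry cl ->
    rks cl (addp U [::]) s = rks cl U s.
  by move=> cP; apply: (rks_ext cP) => z; split; [case | left].
apply/eqP; rewrite eqn_leq -{1}(nil_ext _ (acl j)) // -{1}(nil_ext _ (acl iota)) //.
rewrite (up [::]) /=.
pose e := enum I.
have tot : (rks (acl iota) (addp none t) [seq x k | k <- w ++ e] <=
    rks (acl j) none [seq (ev' \o y) k | k <- w ++ e])%N.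
  apply: (@leq_trans (rks (acl iota) (addp none t) [seq x k | k <- e])).
    apply: (rks_sub clP) => z; rewrite map_cat mem_cat => /orP[/mapP[k _ ->]|//].
    by rewrite map_f // mem_enum.
  rewrite -/xs -szb; apply: leq_trans b' _; apply: (rks_sub cljP).
  move=> _ /mapP[z zb ->].
  have /bx/mapP[k _ zk] : ev z \in b by rewrite -bE map_f.
  have /sp'/eqP : ev (z - y k) = 0 by rewrite rmorphB yE zk subrr.
  rewrite rmorphB subr_eq0 => /eqP->; apply: map_f.
  by rewrite mem_cat mem_enum orbT.
move: tot; rewrite !map_cat !(rks_cat clP) !(rks_cat cljP).
move=> tot; rewrite -(leq_add2r (rks (acl iota) (addp (addp none t)
  [seq x k | k <- w]) [seq x k | k <- e])).
by apply: leq_trans tot _; rewrite leq_add2l; apply: up.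
Qed.

(** * Generic elements of flats *)

Section Generic.
Variables (K L : fieldType) (iota : {rmorphism K -> L}).
Local Notation cl X := (acl iota (addp none X)).
Local Notation r := (rks (acl iota) none).
Let clP := acl_pregeometry iota.

(** [e] is a root of ['X^l - 'X^k] minus a constant of the closure. *)
Lemma acl_power_diff U e k l : (k < l)%N -> acl iota U (e ^+ l - e ^+ k) -> acl iota U e.
Proof.
move=> lt_kl Ud; have [FC FB _ _] := acl_field iota U.
have F0 : acl iota U 0 by rewrite -(rmorph0 iota).
have F1 : acl iota U 1 by rewrite -(rmorph1 iota).
apply: (algebraic_over_trans (adjoin_field iota U)).
exists ('X^l - 'X^k - (e ^+ l - e ^+ k)%:P); split=> [|i|].
- have : ('X^l - 'X^k - (e ^+ l - e ^+ k)%:P)`_l != 0.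
    rewrite !coefB !coefXn coefC eqxx (gtn_eqF lt_kl) (gtn_eqF (leq_ltn_trans _ lt_kl)) //.
    by rewrite !subr0 oner_eq0.
  by apply: contraNneq => ->; rewrite coef0.
- rewrite !coefB !coefXn coefC.
  by apply: (FB _ _ (FB _ _ _ _)); do ?case: ifP; do ?case: eqP.
- by rewrite /root !(hornerD, hornerN, hornerXn, hornerC) subrr.
Qed.

(** A field is not a finite union of proper relatively algebraically closed
    subfields: if [e] avoids all but the one containing it and [y] avoids that
    one, then [y - e ^+ k] avoids all of them for large [k]. *)
Lemma avoid_closures (V : L -> Prop) (Xs : seq (seq L)) : intermediate_field iota V ->
    (forall X, X \in Xs -> exists2 u, V u & ~ cl X u) ->
  exists2 e, V e & forall X, X \in Xs -> ~ cl X e.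
Proof.
move=> hV; have [VC VB VM _] := hV.
have VX e k : V e -> V (e ^+ k).
  elim: k => [|k IHk] Ve; first by rewrite expr0 -(rmorph1 iota).
  by rewrite exprS; apply: VM => //; apply: IHk.
elim: Xs => [|X Xs IHXs] avoid; first by exists 0; rewrite // -(rmorph0 iota).
have [|e Ve ne] := IHXs; first by move=> Y YXs; apply: avoid; rewrite inE YXs orbT.
have [Xe|nXe] := pselect (cl X e); last first.
  by exists e => // Y; rewrite inE => /orP[/eqP->|/ne].
have [y Vy nXy] := avoid X (mem_head _ _).
(* Each closure contains [y - e ^+ k] for at most one [k]: the difference of two
   such elements would put [e] into it. *)
have [N NP] : exists N, forall k, (N <= k)%N -> forall Y, Y \in Xs -> ~ cl Y (y - e ^+ k).
  elim: Xs ne {IHXs avoid} => [|Y Xs IHXs] ne; first by exists 0%N.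
  have [|N NP] := IHXs; first by move=> Z ZXs; apply: ne; rewrite inE ZXs orbT.
  have [[k Yk]|nY] := pselect (exists k, cl Y (y - e ^+ k)); last first.
    exists N => k le_Nk Z; rewrite inE => /orP[/eqP->|]; last exact: NP.
    by move=> Yk; apply: nY; exists k.
  exists (maxn N k.+1) => l; rewrite geq_max => /andP[le_Nl lt_kl] Z.
  rewrite inE => /orP[/eqP->|]; last exact: NP.
  move=> Yl; apply: (ne Y (mem_head _ _)); apply: (acl_power_diff lt_kl).
  have [_ FB _ _] := acl_field iota (addp none Y).
  by have := FB _ _ Yk Yl; rewrite opprB addrC addrA subrK.
exists (y - e ^+ N) => [|Y]; first by apply: VB => //; apply: VX.
rewrite inE => /orP[/eqP->|/NP]; last exact.
have [FC FB FM _] := acl_field iota (addp none X).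
have Xek : cl X (e ^+ N).
  elim: N {NP} => [|n IHn]; first by rewrite expr0 -(rmorph1 iota).
  by rewrite exprS; apply: FM.
move=> Xye; apply: nXy; rewrite -[y](subrK (e ^+ N)).
have -> : y - e ^+ N + e ^+ N = y - e ^+ N - (0 - e ^+ N) by rewrite sub0r opprK.
by apply: (FB) => //; apply: FB => //; rewrite -(rmorph0 iota).
Qed.

Lemma generic_element (U : seq L) (Xs : seq (seq L)) :
  exists2 e, cl U e & forall X, X \in Xs -> cl X e -> forall u, u \in U -> cl X u.
Proof.
pose Ys := [seq X <- Xs | `[< exists2 u, cl U u & ~ cl X u >]].
have [||e Ue ne] := @avoid_closures (cl U) Ys; first exact: acl_field.
  by move=> X; rewrite mem_filter => /andP[/asboolP].
exists e => // X XXs Xe u uU; apply: contrapT => nXu.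
apply: (ne X) Xe; rewrite mem_filter XXs andbT; apply/asboolP.
by exists u => //; apply: cl_in.
Qed.

Lemma rk_mem s t : s =i t -> r s = r t.
Proof.
by move=> st; apply/eqP; rewrite eqn_leq !(rks_sub clP) // => z; rewrite st.
Qed.

(** A generic element of the flat [u i] raises the rank of a set by one, unless
    the set already spans [u i]. So the new rank is the smaller of the rank plus
    one and of the rank after adding all of [u i]; iterating over [idx], where
    an index may occur several times, gives a minimum over the sets [A] of flats
    that are added entirely. The set [D] serves the induction, which adds flats
    to it. *)
Lemma generic_elements (E : finType) (u : E -> seq L) (ws : seq (seq L)) (idx : seq E) :
  exists t, forall W, W \in ws -> forall D : {set E},
    (forall A : {set E}, r (W ++ gens u D ++ t) <=
       r (W ++ gens u (D :|: A)) + count [predC A] idx)%N /\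
    exists A : {set E}, (r (W ++ gens u (D :|: A)) + count [predC A] idx <=
       r (W ++ gens u D ++ t))%N.
Proof.
elim: idx => [|i idx [t IHt]].
  exists [::] => W _ D; split=> [A|]; last by exists set0; rewrite setU0 cats0 addn0.
  rewrite addn0 cats0; apply: (rks_sub clP) => z; rewrite !mem_cat.
  case/orP => [->//|/gensP[k kD zk]]; apply/orP; right; apply/gensP.
  by exists k => //; rewrite inE kD.
pose X W D := W ++ gens u D ++ t.
have [e ue ge] := generic_element (u i) [seq X W D | W <- ws, D <- enum {set E}].
exists (rcons t e) => W Wws D; have {}IHt := IHt W Wws.
have XE : W ++ gens u D ++ rcons t e = X W D ++ [:: e].
  by rewrite /X -cats1 -!catA.
have rXe : r (X W D ++ [:: e]) = (r (X W D) + ~~ `[< cl (X W D) e >])%N.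
  by rewrite (rks_cat clP) /= addn0.
have le_i : (r (X W D ++ [:: e]) <= r (X W (i |: D)))%N.
  apply: (rks_span clP) => z; rewrite mem_cat mem_seq1 => /orP[zX|/eqP->].
    apply: (cl_in clP); move: zX; rewrite !mem_cat => /or3P[->//||->]; last first.
      by rewrite !orbT.
    move=> /gensP[k kD zk]; apply/orP; right; apply/orP; left; apply/gensP.
    by exists k => //; rewrite inE kD orbT.
  apply: (cl_mono clP) ue => v [//|vi]; right; rewrite !mem_cat.
  apply/orP; right; apply/orP; left; apply/gensP; exists i => //.
  by rewrite inE set11.
have in_i : cl (X W D) e -> r (X W (i |: D)) = r (X W D).
  move=> /ge; rewrite allpairs_f ?mem_enum // => /(_ isT) ui; apply/eqP.
  rewrite eqn_leq; apply/andP; split; last first.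
    by apply: leq_trans le_i; rewrite rXe leq_addr.
  apply: (rks_span clP) => z; rewrite /X !mem_cat => /or3P[zW||zt].
  - by apply: (cl_in clP); rewrite !mem_cat zW.
  - move=> /gensP[k]; rewrite inE => /orP[/set1P->|kD zk]; first exact: ui.
    apply: (cl_in clP); rewrite !mem_cat; apply/orP; right; apply/orP; left.
    by apply/gensP; exists k.
  - by apply: (cl_in clP); rewrite !mem_cat zt !orbT.
have up (A : {set E}) : (r (X W D ++ [:: e]) <=
    r (W ++ gens u (D :|: A)) + count [predC A] (i :: idx))%N.
  have [iA|niA] := boolP (i \in A); rewrite /= ?iA ?niA.
    apply: leq_trans le_i _; have [/(_ A) le_A _] := IHt (i |: D).
    suff <- : (i |: D) :|: A = D :|: A by rewrite add0n.
    by rewrite -setUA; apply/setUidPr; rewrite sub1set inE iA orbT.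
  rewrite rXe addnCA addnC; apply: leq_add; first by case: `[< _ >].
  by have [/(_ A)] := IHt D.
rewrite XE; split=> //; rewrite rXe.
have [Xe|nXe] := pselect (cl (X W D) e).
  have [_ [A leA]] := IHt (i |: D); exists (i |: A); rewrite asboolT // addn0.
  rewrite -(in_i Xe); apply: leq_trans leA; rewrite setUCA setUA.
  rewrite leq_add2l /= setU11 add0n; apply: sub_count => k /=.
  by rewrite !inE negb_or => /andP[].
have [_ [A leA]] := IHt D; exists A; rewrite asboolF //.
have := up A; rewrite rXe asboolF //= addn1.
have [iA|niA] := boolP (i \in A); rewrite /= ?iA ?niA /= ?add0n ?add1n.
  by move=> /leq_trans/(_ leA); rewrite ltnn.
by move=> _; rewrite addnS ltnS.
Qed.

End Generic.

Local Close Scope ring_scope.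

(** * Direct sums and the correspondence *)

(** [transfer] for a family of finite lists, indexed by the entries. *)
Lemma transfer_family (K L M : fieldType) (iota : {rmorphism K -> L})
    (kappa : {rmorphism K -> M}) (E : finType) (t : seq L) (f : E -> seq L) :
  exists (M' : fieldType) (j : {rmorphism M -> M'}) (f' : E -> seq M'),
    (forall S, rks (acl j) none (gens f' S) =
               rks (acl iota) (addp none t) (gens f S)) /\
    (t = [::] -> forall S, rks (acl (j \o kappa)) none (gens f' S) <=
               rks (acl iota) none (gens f S)).
Proof.
have clP := acl_pregeometry iota.
pose I := seq_sub (gens f setT).
have [M' [j [x' [rx' le_x']]]] := transfer iota kappa t (fun k : I => ssval k).
pose w i := [seq k <- enum {: I} | ssval k \in f i].
exists M', j, (fun i => [seq x' k | k <- w i]).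
have f'E S : gens (fun i => [seq x' k | k <- w i]) S = [seq x' k | k <- gens w S].
  by rewrite /gens map_flatten -map_comp.
have fE S : [seq ssval k | k <- gens w S] =i gens f S.
  move=> z; apply/mapP/gensP => [[k /gensP[i iS]]|[i iS zi]].
    by rewrite mem_filter => /andP[ki _] ->; exists i.
  have zT : z \in gens f setT by apply/gensP; exists i; rewrite ?inE.
  exists (SeqSub zT) => //; apply/gensP; exists i => //.
  by rewrite mem_filter zi mem_enum.
have rkE U S : rks (acl iota) U [seq ssval k | k <- gens w S] = rks (acl iota) U (gens f S).
  by apply/eqP; rewrite eqn_leq !(rks_sub clP) // => z; rewrite fE.
by split=> [S|t0 S]; rewrite f'E -rkE ?rx' // le_x'.
Qed.

Lemma gens_map (E : finType) (T T' : eqType) (f : E -> seq T) (h : T -> T') S :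
  gens (fun i => map h (f i)) S = map h (gens f S).
Proof. by rewrite /gens map_flatten -map_comp. Qed.

(** The field of [Q] takes the place of [M] in [transfer_family], so that the
    elements of [P] become free from those of [Q]. *)
Lemma algebraic_direct_sum (K : fieldType) (E1 E2 : finType) (P : polymatroid E1)
    (Q : polymatroid E2) : algebraic K P -> algebraic K Q ->
  exists (L : fieldType) (iota : {rmorphism K -> L}) (p : E1 -> seq L) (q : E2 -> seq L),
    forall A B, rks (acl iota) none (gens p A ++ gens q B) = P A + Q B.
Proof.
move=> /algebraicP[LP [iP [p pP]]] /algebraicP[LQ [iQ [q qQ]]].
have [L [j [p' [p'E p'le]]]] := transfer_family iP iQ [::] p.
exists L, (j \o iQ), p', (fun i => map j (q i)) => A B; rewrite gens_map.
have clP := acl_pregeometry (j \o iQ).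
rewrite (rks_catC clP) (rks_cat clP) addnC; congr (_ + _).
  apply/eqP; rewrite eqn_leq -pP; apply/andP; split.
    apply: leq_trans (p'le erefl A); apply: (rks_le clP) => z Uz.
    by apply: acl_ext; left.
  rewrite -(rks_ext (acl_pregeometry iP) (U := addp none [::])); last first.
    by move=> z; split; [case | left].
  rewrite -p'E; apply: rks_acl_le => [c|z [//|/mapP[y _ ->]]]; exact: (acl_const j).
rewrite -qQ -[in RHS](map_id (gens q B)).
apply/eqP; rewrite eqn_leq; apply/andP; split; apply: rks_le_map;
  do ?exact: acl_pregeometry; move=> w z clz.
  have := acl_img j clz; apply: (cl_mono clP) => _ [u [//|uw] ->]; right.
  by rewrite map_id in uw; apply: map_f.
apply: (acl_img_inv (j := j)); apply: (cl_mono clP) clz => u [//|/mapP[v vw ->]].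
by exists v => //; right; rewrite map_id.
Qed.

Lemma count_complement (E : finType) (a : {ffun E -> nat}) (A : {set E}) :
  count [predC A] (flatten [seq nseq (a i) i | i <- enum E]) = wt a (~: A).
Proof.
rewrite count_flatten -map_comp sumnE big_map big_enum /wt big_mkcond [RHS]big_mkcond.
apply: eq_bigr => i _; rewrite /= count_nseq /=.
by rewrite in_setC; case: (i \in A) => /=; rewrite ?mul0n ?mul1n.
Qed.

Theorem proposition6p3 (m n : nat) (hm : 0 < m) (hn : 0 < n)
  (alpha : {ffun 'I_m -> nat}) (beta : {ffun 'I_n -> nat})
  (C : cagedPolymatroid (cage_sum alpha beta)) (K : fieldType)
  (hC : algebraic K C)
  (P : cagedPolymatroid alpha) (hP : algebraic K P) :
  algebraic K (correspondence C P).
Proof.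
have [L [iota [p [c pcE]]]] := algebraic_direct_sum hP hC.
have clP := acl_pregeometry iota.
pose u i := p i ++ c (inl i); pose v j := c (inr j).
pose idx := flatten [seq nseq (alpha i) i | i <- enum 'I_m].
have [t tP] := generic_elements iota u [seq gens v D | D <- enum {set 'I_n}] idx.
(* [g S] is the minimum of [correspondence_rank], realized as a rank. *)
pose g S := rks (acl iota) none (gens v S ++ t).
have flatE S A : rks (acl iota) none (gens v S ++ gens u (set0 :|: A)) =
    P A + C (inl @: A :|: inr @: S).
  rewrite -pcE set0U; apply: rk_mem => z; rewrite !mem_cat.
  apply/orP/orP => [[/gensP[j jS zj]|/gensP[i iA]]|[/gensP[i iA zi]|/gensP[s]]].
  - by right; apply/gensP; exists (inr j); rewrite // inE imset_f ?orbT.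
  - rewrite mem_cat => /orP[zi|zi]; [left|right]; apply/gensP; first by exists i.
    by exists (inl i); rewrite // inE imset_f.
  - by right; apply/gensP; exists i; rewrite // mem_cat zi.
  - rewrite inE => /orP[]/imsetP[i iS ->] zi; [right|left]; apply/gensP; exists i => //.
    by rewrite mem_cat zi orbT.
have gE S : g S = rks (acl iota) none (gens v S ++ gens u set0 ++ t).
  by rewrite /g /gens enum_set0.
have memS S : gens v S \in [seq gens v D | D <- enum {set 'I_n}].
  by rewrite map_f // mem_enum.
have corrE S : correspondence C P S + g set0 = g S.
  apply: correspondence_rank => {}S.
    move=> A; have [/(_ A) + _] := tP _ (memS S) set0.
    by rewrite -gE flatE count_complement.
  have [_ [A]] := tP _ (memS S) set0; rewrite -gE flatE count_complement.
  by exists A.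
have [M [j [v' [v'E _]]]] := transfer_family iota (idfun : {rmorphism K -> K}) t v.
apply/algebraicP; exists M, j, v' => S; rewrite v'E.
have g0 : g set0 = rks (acl iota) none t by rewrite /g /gens enum_set0.
apply/eqP; rewrite -(eqn_add2r (g set0)) corrE g0 /g (rks_catC clP).
by rewrite (rks_cat clP) addnC.
Qed.
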